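(* Let $d\ge 2$ be a fixed integer. For the $d$-Hyperedge-Estimation problem and the $d$-Hyperedge-Sample problem (defined below), there are randomized algorithms solving them using $\mathcal{O}_d\!\left(\frac{\log^{3d+5} n}{\varepsilon^2}\right)$ and $\mathcal{O}_d\!\left(\frac{\log^{3d+9} n}{\varepsilon^2}\right)$ CID queries, respectively.
   Context: A $d$-uniform hypergraph $\mathcal{H}=(U,\mathcal{F})$ has vertex set $U$, $|U|=n$, and hyperedge set $\mathcal{F}$ of $d$-element subsets of $U$; $m=|\mathcal{F}|$. For subsets $A_1,\dots,A_d\subseteq U$, $m(A_1,\dots,A_d)$ is the number of hyperedges having exactly one vertex in each $A_i$. The CID oracle takes $d$ pairwise disjoint nonempty subsets $A_1,\dots,A_d\subseteq U$ and answers Yes iff $m(A_1,\dots,A_d)\neq0$. $d$-Hyperedge-Estimation: given $U$, CID oracle access to $\mathcal{H}$ and $\varepsilon\in(0,1)$, output $\widehat m$ with $|\widehat m-m|\le\varepsilon m$ with probability $1-1/n^{\Omega(d)}$. $d$-Hyperedge-Sample: given the same input, with probability $1-1/n^{\Omega(d)}$ output a sample from a distribution on hyperedges of $\mathcal{H}$ under which each hyperedge is sampled with probability in $[(1-\varepsilon)/m,(1+\varepsilon)/m]$. $\mathcal{O}_d(\cdot)$ hides constants depending only on $d$; logarithms are base 2. *)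

(* Defs.v *)
From HB Require Import structures.
From mathcomp Require Import all_boot all_order all_algebra.
From mathcomp Require Import reals exp.

Set Implicit Arguments.
Unset Strict Implicit.
Unset Printing Implicit Defensive.

Import Order.TTheory GRing.Theory Num.Theory.

Local Open Scope ring_scope.

Record hypergraph (U : finType) (d : nat) := Hypergraph {
  hyperedges : {set {set U}};
  hyperedges_uniform : [forall e in hyperedges, #|e| == d]
}.

Section CID.
Variables (U : finType) (d : nat).
Implicit Types (H : hypergraph U d) (A : {ffun 'I_d -> {set U}}).

Definition num_hyperedges H : nat := #|hyperedges H|.

(* m(A_1, ..., A_d) *)
Definition num_crossing H A : nat :=
  #|[set e in hyperedges H | [forall i, #|e :&: A i| == 1%N]]|.

Definition valid_query A : bool :=
  [forall i, A i != set0] &&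
  [forall i, forall j, (i != j) ==> [disjoint A i & A j]].

Definition cid_query := {A : {ffun 'I_d -> {set U}} | valid_query A}.

Definition cid_oracle H (Q : cid_query) : bool := num_crossing H (val Q) != 0%N.

(* Deterministic adaptive query algorithms.  The hypergraph occurs nowhere in
   the tree: it influences a run only through the answers of the oracle. *)
Inductive decision_tree (T : Type) : Type :=
| Output of T
| Ask of cid_query & (bool -> decision_tree T).

Fixpoint tree_output T (O : cid_query -> bool) (t : decision_tree T) : T :=
  match t with
  | Output x => x
  | Ask Q k => tree_output O (k (O Q))
  end.

Fixpoint tree_queries T (O : cid_query -> bool) (t : decision_tree T) : nat :=
  match t with
  | Output _ => 0
  | Ask Q k => (tree_queries O (k (O Q))).+1
  end.

(* A randomized query algorithm is a probability distribution over
   deterministic ones, presented by a uniformly random seed. *)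
Record rand_alg (T : Type) := RandAlg {
  seed : finType;
  seed_gt0 : (0 < #|seed|)%N;
  tree_of_seed : seed -> decision_tree T
}.

Definition alg_output T (alg : rand_alg T) H (w : seed alg) : T :=
  tree_output (cid_oracle H) (tree_of_seed w).

Definition alg_queries T (alg : rand_alg T) H (w : seed alg) : nat :=
  tree_queries (cid_oracle H) (tree_of_seed w).

End CID.

Section Problems.
Variable R : realType.

Definition log2 (x : R) : R := ln x / ln 2.

Definition unif_pr (Omega : finType) (E : {set Omega}) : R :=
  #|E|%:R / #|Omega|%:R.

Definition unif_cond_pr (Omega : finType) (E G : {set Omega}) : R :=
  unif_pr (E :&: G) / unif_pr G.

(* The success probability 1 - 1/n^(c d), n being the number of vertices. *)
Definition success_bound (c : R) (n d : nat) : R :=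
  1 - (n%:R `^ (c * d%:R))^-1.

Definition solves_estimation (U : finType) (d : nat) (c eps : R)
    (H : hypergraph U d) (alg : rand_alg U d R) : Prop :=
  success_bound c #|U| d <=
  unif_pr [set w : seed alg |
    `|alg_output H w - (num_hyperedges H)%:R| <= eps * (num_hyperedges H)%:R].

(* There is an event G, of high probability, conditionally on which the output
   is a hyperedge whose distribution is pointwise (1 +- eps)-close to uniform.
   An arbitrary set may be returned outside G.  Nothing is required when H has
   no hyperedge, since there is then no distribution on its hyperedges. *)
Definition solves_sampling (U : finType) (d : nat) (c eps : R)
    (H : hypergraph U d) (alg : rand_alg U d {set U}) : Prop :=
  (0 < num_hyperedges H)%N ->
  exists G : {set seed alg},
    [/\ success_bound c #|U| d <= unif_pr G,
        forall w, w \in G -> alg_output H w \in hyperedges H &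
        forall e, e \in hyperedges H ->
          (1 - eps) / (num_hyperedges H)%:R
            <= unif_cond_pr [set w | alg_output H w == e] G
            <= (1 + eps) / (num_hyperedges H)%:R].

Definition query_cost_le (U : finType) (d : nat) (T : Type) (b : R)
    (H : hypergraph U d) (alg : rand_alg U d T) : Prop :=
  forall w : seed alg, (alg_queries H w)%:R <= b.

End Problems.

(* Main.v *)
Require Import Defs.
From HB Require Import structures.
From mathcomp Require Import all_boot all_order all_algebra.
From mathcomp Require Import reals exp.
From mathcomp Require Import boolp zify ring lra.

(* Count ordered hyperedges t : 'I_d -> U, of which there are d! m; a query on
   disjoint sets asks whether one of them lies in a box A_1 x ... x A_d.

   Coarse counting. Colourings from a family that is rainbow on every d-set make
   the coordinates of a box disjoint. Thin the i-th coordinate at rate 2^-j_i: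
   with j_1 + ... + j_d = r, some tuple survives for some j with probability at
   most (L+1)^(d-1) m / 2^r, and with probability close to 1 once 2^r W^d <= m
   for W = O(log n), by picking a dyadic degree class in each coordinate in turn.
   Majority votes turn this into an estimate within a polylogarithmic factor b,
   correct for all dyadic boxes at once.

   Fine counting. Splitting the boxes along the L = O(log n) bits of a vertex
   number gives a tree whose leaves are single tuples. A population of N
   weighted boxes is pushed down the tree, resampling the children in proportion
   to weight times coarse estimate. The weighted count is a martingale whose
   second moment grows by a factor 1 + O(b / N) per level, so that
   N = O(L b / eps^2) suffices by the Chebyshev inequality.

   Sampling. Descend the tree, choosing each child in proportion to its fine
   estimate with precision O(eps / L). *)

Set Implicit Arguments.
Unset Strict Implicit.
Unset Printing Implicit Defensive.

Import Order.TTheory GRing.Theory Num.Theory.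

Local Open Scope ring_scope.

(** * Expectations over uniform finite types *)

(** The boxes met by the fine count depend on earlier random choices, so coarse estimates that are
    right for each fixed box would not do. Hence the thinning seeds are drawn once, and a union
    bound over all 2^O(dL) boxes of the tree makes them right everywhere; this costs K = O(L) votes.
    Given such seeds, the fine count is a martingale in its own, independent seed.

    Randomness is a uniform element of a finite set, so a choice in given proportions is a map out
    of some 'I_M with fibres of suitable sizes. The population tolerates rounded fibres, because its
    weights are divided by the true fibre sizes; the descent has no weights and needs an M that
    makes the fibres exact.

    Cost of the fine count in powers of L: the K repetitions give 1, the levels 1, the population
    2d+1 and a coarse estimate d+2, in all 3d+5. The sampler adds 1 for its levels and 2 for the
    precision eps / L. *)

Section FfunCons.
Variable Y : Type.

Definition fcons n (y : Y) (f : {ffun 'I_n -> Y}) : {ffun 'I_n.+1 -> Y} :=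
  [ffun i => if unlift ord0 i is Some j then f j else y].

Definition ftail n (f : {ffun 'I_n.+1 -> Y}) : {ffun 'I_n -> Y} :=
  [ffun j => f (lift ord0 j)].

Lemma fcons0 n y (f : {ffun 'I_n -> Y}) : fcons y f ord0 = y.
Proof. by rewrite ffunE unlift_none. Qed.

Lemma fconsS n y (f : {ffun 'I_n -> Y}) j : fcons y f (lift ord0 j) = f j.
Proof. by rewrite ffunE liftK. Qed.

Lemma fconsK n y (f : {ffun 'I_n -> Y}) : ftail (fcons y f) = f.
Proof. by apply/ffunP => j; rewrite ffunE fconsS. Qed.

Lemma fcons_eta n (f : {ffun 'I_n.+1 -> Y}) : fcons (f ord0) (ftail f) = f.
Proof.
apply/ffunP => i; rewrite ffunE; case: unliftP => [j ->|->] //.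
by rewrite ffunE.
Qed.

End FfunCons.

Lemma big_fcons (Y : finType) (T : Type) (idx : T) (op : Monoid.com_law idx) n
    (F : {ffun 'I_n.+1 -> Y} -> T) :
  \big[op/idx]_f F f = \big[op/idx]_y \big[op/idx]_f F (fcons y f).
Proof.
rewrite pair_big /=.
rewrite (reindex (fun p : Y * {ffun 'I_n -> Y} => fcons p.1 p.2)) //=.
exists (fun f : {ffun _ -> _} => (f ord0, ftail f)) => [[y f] _|f _] /=; last exact: fcons_eta.
by rewrite fcons0 fconsK.
Qed.

Section Expectation.
Variable R : realFieldType.

Definition Ex (T : finType) (f : T -> R) : R := (\sum_x f x) / #|T|%:R.

Section Basic.
Variable T : finType.
Implicit Types f g : T -> R.

Lemma eq_Ex f g : f =1 g -> Ex f = Ex g.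
Proof. by move=> fg; rewrite /Ex; congr (_ / _); apply: eq_bigr. Qed.

Lemma ExD f g : Ex (fun x => f x + g x) = Ex f + Ex g.
Proof. by rewrite /Ex big_split mulrDl. Qed.

Lemma ExZ a f : Ex (fun x => a * f x) = a * Ex f.
Proof. by rewrite /Ex -mulr_sumr mulrA. Qed.

Lemma ExN f : Ex (fun x => - f x) = - Ex f.
Proof. by rewrite /Ex sumrN mulNr. Qed.

Lemma Ex_sum (I : finType) (P : pred I) (F : I -> T -> R) :
  Ex (fun x => \sum_(i | P i) F i x) = \sum_(i | P i) Ex (F i).
Proof. by rewrite /Ex exchange_big mulr_suml. Qed.

Lemma le_Ex f g : (forall x, f x <= g x) -> Ex f <= Ex g.
Proof.
by move=> fg; rewrite /Ex ler_wpM2r ?invr_ge0 ?ler0n //; apply: ler_sum.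
Qed.

Lemma Ex_ge0 f : (forall x, 0 <= f x) -> 0 <= Ex f.
Proof. by move=> f0; rewrite /Ex divr_ge0 ?ler0n // sumr_ge0. Qed.

Hypothesis T0 : (0 < #|T|)%N.

Lemma Ex_cst a : Ex (fun _ : T => a) = a.
Proof. by rewrite /Ex sumr_const -[a *+ _]mulr_natr mulfK // pnatr_eq0 -lt0n. Qed.

Lemma Ex_le_cst f a : (forall x, f x <= a) -> Ex f <= a.
Proof. by move=> fa; rewrite -[leRHS]Ex_cst; exact: le_Ex. Qed.

Lemma Ex_compl (P : pred T) :
  Ex (fun x => (~~ P x)%:R) = 1 - Ex (fun x => (P x)%:R).
Proof.
rewrite -[X in X - _]Ex_cst -ExN -ExD; apply: eq_Ex => x.
by case: (P x); rewrite ?subrr ?subr0.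
Qed.

Lemma Ex_eq0 f : (forall x, 0 <= f x) -> Ex f = 0 -> forall x, f x = 0.
Proof.
move=> f0 /eqP; rewrite /Ex mulf_eq0 invr_eq0 pnatr_eq0 (gtn_eqF T0) orbF.
by rewrite psumr_eq0 // => /allP fz x; apply/eqP/(implyP (fz x (mem_index_enum x))).
Qed.

End Basic.

Lemma Ex_pair (A B : finType) (F : A * B -> R) :
  Ex F = Ex (fun a => Ex (fun b => F (a, b))).
Proof.
rewrite /Ex card_prod natrM invfM -mulr_suml mulrA mulrAC; congr (_ / _ / _).
by rewrite pair_big; apply: eq_bigr => [[]].
Qed.

Lemma Ex_fcons (Y : finType) n (F : {ffun 'I_n.+1 -> Y} -> R) :
  Ex F = Ex (fun y => Ex (fun f => F (fcons y f))).
Proof.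
rewrite /Ex !card_ffun !card_ord -mulr_suml expnS natrM invfM mulrA mulrAC.
by rewrite big_fcons.
Qed.

Lemma Ex_prod_ffun (I Y : finType) (g : I -> Y -> R) :
  Ex (fun f : {ffun I -> Y} => \prod_i g i (f i)) = \prod_i Ex (g i).
Proof.
rewrite /Ex card_ffun natrX big_split /= prodr_const exprVn.
by rewrite (bigA_distr_bigA g).
Qed.

Lemma Ex_ffun_at (I Y : finType) (i : I) (g : Y -> R) : (0 < #|Y|)%N ->
  Ex (fun f : {ffun I -> Y} => g (f i)) = Ex g.
Proof.
move=> Y0.
transitivity (Ex (fun f : {ffun I -> Y} =>
   \prod_k (if k == i then g (f k) else 1))).
  by apply: eq_Ex => f; rewrite -big_mkcond big_pred1_eq.
rewrite (Ex_prod_ffun (fun k y => if k == i then g y else 1)).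
rewrite (bigD1 i) //= eqxx big1 ?mulr1 // => k /negPf ->.
exact: Ex_cst.
Qed.

Lemma prod_bool (I : finType) (P : pred I) :
  \prod_i (P i)%:R = [forall i, P i]%:R :> R.
Proof.
have [/forallP H|/forallPn[i nPi]] := boolP [forall i, P i].
  by rewrite big1 // => i _; rewrite H.
by rewrite (bigD1 i) //= (negPf nPi) mul0r.
Qed.

Lemma Ex_forall_ffun (I Y : finType) (P : I -> pred Y) :
  Ex (fun f : {ffun I -> Y} => [forall i, P i (f i)]%:R) =
  \prod_i Ex (fun y => (P i y)%:R).
Proof.
rewrite -Ex_prod_ffun; apply: eq_Ex => f.
by rewrite (prod_bool (fun i => P i (f i))).
Qed.

Lemma union_bound (T I : finType) (P : pred I) (Bad : I -> pred T) (p : R) :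
  (forall i, P i -> Ex (fun x => (Bad i x)%:R) <= p) ->
  Ex (fun x => [exists i, P i && Bad i x]%:R) <= #|P|%:R * p.
Proof.
move=> Hp; apply: (@le_trans _ _ (\sum_(i | P i) p)); last first.
  by rewrite sumr_const mulr_natl.
apply: le_trans (ler_sum _ Hp); rewrite -Ex_sum; apply: le_Ex => x.
case: existsP => [[i /andP[Pi Bi]]|_]; last by apply: sumr_ge0 => i _; rewrite ler0n.
by rewrite (bigD1 i) //= Bi lerDl sumr_ge0 // => j _; rewrite ler0n.
Qed.

(** Exponential moment in base 16: if half of the K trials fail, 16 to the number of failures is at
    least 4 ^ K, while its mean is at most (1 + 15 / 16) ^ K <= 2 ^ K. *)
Lemma majority_bound (Y : finType) (P : pred Y) K : (0 < #|Y|)%N ->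
  Ex (fun y => (P y)%:R) <= (16%:R)^-1 ->
  Ex (fun f : {ffun 'I_K -> Y} => (K <= 2 * #|[set i | P (f i)]|)%N%:R)
    <= (2 ^+ K)^-1.
Proof.
move=> Y0 HP.
have bnd (f : {ffun 'I_K -> Y}) : (K <= 2 * #|[set i | P (f i)]|)%N%:R
    <= (4 ^+ K)^-1 * \prod_i (1 + 15 * (P (f i))%:R) :> R.
  have -> : \prod_i (1 + 15 * (P (f i))%:R) = 16 ^+ #|[set i | P (f i)]| :> R.
    rewrite -prodr_const [RHS]big_mkcond /=; apply: eq_bigr => i _.
    by rewrite inE; case: (P _); rewrite ?mulr1 ?mulr0 ?addr0 //; ring.
  have [le|_] := leqP; last by rewrite mulr_ge0 ?invr_ge0 ?exprn_ge0.
  have -> : 16 = 4 ^+ 2 :> R by ring.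
  by rewrite mulrC ler_pdivlMr ?exprn_gt0 // mul1r -exprM ler_weXn2l // ler1n.
apply: le_trans (le_Ex bnd) _; rewrite ExZ.
rewrite (Ex_prod_ffun (fun _ y => 1 + 15 * (P y)%:R)) prodr_const card_ord.
rewrite ExD Ex_cst // ExZ.
have p0 : 0 <= Ex (fun y => (P y)%:R) by apply: Ex_ge0 => y; rewrite ler0n.
have -> : (2 ^+ K)^-1 = (4 ^+ K)^-1 * 2 ^+ K :> R.
  have -> : 4 = 2 * 2 :> R by ring.
  by rewrite exprMn invfM mulfVK // expf_neq0 // pnatr_eq0.
rewrite ler_wpM2l ?invr_ge0 ?exprn_ge0 // lerXn2r ?nnegrE //; lra.
Qed.

Lemma markov_ex (T : finType) (f : T -> R) (a : R) : 0 < a ->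
  (forall x, 0 <= f x) -> Ex (fun x => (a < f x)%R%:R) <= Ex f / a.
Proof.
move=> a0 f0; rewrite [Ex f / a]mulrC -ExZ; apply: le_Ex => x.
case: ltP => [/ltW|_]; last by rewrite mulr_ge0 ?invr_ge0 // ltW.
by rewrite mulrC ler_pdivlMr ?mul1r.
Qed.

End Expectation.

Lemma Ex_unif_pr (R : realType) (Om : finType) (E : {set Om}) :
  unif_pr R E = Ex (fun x => (x \in E)%:R).
Proof.
rewrite /unif_pr /Ex -sum1_card natr_sum big_mkcond; congr (_ / _).
by apply: eq_bigr => x _; case: (x \in E).
Qed.

(** * Decision trees and ordered hyperedges *)

Section QueryComplexity.
Variables (U : finType) (d : nat).
Local Notation oracle := (cid_query U d -> bool).

(** Lets an algorithm be written as a plain function of the oracle; the tree and its worst-case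
    query bound are recovered compositionally. *)
Definition computable T (q : nat) (F : oracle -> T) : Prop :=
  exists t : decision_tree U d T,
    forall O, tree_output O t = F O /\ (tree_queries O t <= q)%N.

Fixpoint tree_bind T T' (t : decision_tree U d T)
    (g : T -> decision_tree U d T') : decision_tree U d T' :=
  match t with
  | Output x => g x
  | Ask Q k => Ask Q (fun b => tree_bind (k b) g)
  end.

Lemma tree_bind_output T T' (t : decision_tree U d T) (g : T -> _ T') O :
  tree_output O (tree_bind t g) = tree_output O (g (tree_output O t)).
Proof. by elim: t => //= Q k IH; exact: IH. Qed.

Lemma tree_bind_queries T T' (t : decision_tree U d T) (g : T -> _ T') O :
  tree_queries O (tree_bind t g) =
  (tree_queries O t + tree_queries O (g (tree_output O t)))%N.
Proof. by elim: t => //= Q k IH; rewrite IH. Qed.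

Lemma computable_cst T (x : T) : computable 0 (fun _ => x).
Proof. by exists (Output _ _ x). Qed.

Lemma eq_computable T q (F G : oracle -> T) :
  F =1 G -> computable q F -> computable q G.
Proof. by move=> FG [t Ht]; exists t => O; rewrite -FG. Qed.

Lemma computable_le T (q q' : nat) (F : oracle -> T) :
  (q <= q')%N -> computable q F -> computable q' F.
Proof.
by move=> le [t H]; exists t => O; have [-> /leq_trans ->] := H O.
Qed.

Lemma computable_bind T T' q q' (F : oracle -> T) (G : T -> oracle -> T') :
  computable q F -> (forall x, computable q' (G x)) ->
  computable (q + q') (fun O => G (F O) O).
Proof.
move=> [t Ht] /choice[g Hg]; exists (tree_bind t g) => O.
rewrite tree_bind_output tree_bind_queries.
have [-> le1] := Ht O; have [-> le2] := Hg (F O) O.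
by split=> //; exact: leq_add.
Qed.

Lemma computable_map T T' q (F : oracle -> T) (g : T -> T') :
  computable q F -> computable q (fun O => g (F O)).
Proof.
move=> cF; rewrite -[q]addn0.
by apply: (computable_bind (G := fun x _ => g x) cF) => x; exact: computable_cst.
Qed.

Lemma computable_table (I : finType) T (x0 : T) q (F : I -> oracle -> T) :
  (forall i, computable q (F i)) ->
  computable (#|I| * q) (fun O => [ffun i => F i O]).
Proof.
move=> cF.
have cs (s : seq I) : computable (size s * q) (fun O => [seq F i O | i <- s]).
  elim: s => [|i s IH]; first exact: computable_cst.
  apply: (computable_bind (G := fun x O => x :: [seq F j O | j <- s]) (cF i)).
  by move=> x; exact: (computable_map (cons x)).
rewrite cardE; apply: eq_computable (computable_map
  (fun l => [ffun i => nth x0 l (enum_rank i)]) (cs (enum I))) => O.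
apply/ffunP => i.
by rewrite !ffunE (nth_map i) ?nth_enum_rank // -cardE ltn_ord.
Qed.

(** The default is the right answer when a coordinate is empty. On overlapping sets it may miss
    tuples: the coarse count avoids such boxes by colouring, and leaf boxes with overlaps contain no
    tuple of distinct vertices. *)
Definition query_or_false (O : oracle) (A : {ffun 'I_d -> {set U}}) : bool :=
  if insub A is Some Q then O Q else false.

Lemma computable_query A : computable 1 (fun O => query_or_false O A).
Proof.
rewrite /query_or_false; case: insub => [Q|].
  by exists (Ask Q (fun b => Output _ _ b)).
exact: computable_le (computable_cst _).
Qed.

End QueryComplexity.

(** * Ordered hyperedges and the meaning of a query *)

Section OrderedEdges.
Variables (U : finType) (d : nat).
Implicit Types (H : hypergraph U d) (A B : {ffun 'I_d -> {set U}})
  (t : {ffun 'I_d -> U}).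

Definition ordered_edge H : pred {ffun 'I_d -> U} :=
  fun t => injectiveb t && ([set t i | i in setT] \in hyperedges H).

Definition in_box t A : bool := [forall i, t i \in A i].

Definition disjoint_box A : bool :=
  [forall i, forall j, (i != j) ==> [disjoint A i & A j]].

Lemma in_boxP t A : reflect (forall i, t i \in A i) (in_box t A).
Proof. exact: forallP. Qed.

Lemma disjoint_boxP A i j u :
  disjoint_box A -> u \in A i -> u \in A j -> i = j.
Proof.
move=> /forallP/(_ i)/forallP/(_ j)/implyP D ui uj; apply/eqP/idPn => /D.
by move=> /pred0P/(_ u) /=; rewrite ui uj.
Qed.

Lemma card_hyperedge H e : e \in hyperedges H -> #|e| = d.
Proof.
by case: H => E uE /= eE; apply/eqP; move/forall_inP: uE; apply.
Qed.

Lemma query_or_falseE H A :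
  query_or_false (cid_oracle H) A =
  disjoint_box A && [exists t, ordered_edge H t && in_box t A].
Proof.
rewrite /query_or_false; case: insubP => [Q /andP[_ D] QA|].
  rewrite /cid_oracle QA /disjoint_box D /= /num_crossing cards_eq0.
  apply/set0Pn/existsP => [[e]|[t /andP[/andP[/injectiveP tI tH] /in_boxP tA]]].
    rewrite inE => /andP[eH /forallP cr].
    (* The single vertices of [e] in the sets [A i] are distinct by disjointness, and d distinct
       vertices exhaust [e]. *)
    have /fin_all_exists[f Hf] i : exists x, e :&: A i = [set x].
      exact/cards1P/cr.
    have fin i : f i \in e :&: A i by rewrite Hf set11.
    have fI : injective f.
      move=> i j fij; have /setIP[_ fi] := fin i; have /setIP[_ fj] := fin j.
      by rewrite fij in fi; exact: disjoint_boxP D fi fj.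
    exists (finfun f); apply/andP; split; last first.
      by apply/in_boxP => i; rewrite ffunE; have /setIP[] := fin i.
    apply/andP; split; first by apply/injectiveP => i j; rewrite !ffunE => /fI.
    suff -> : [set finfun f i | i in setT] = e by [].
    apply/eqP; rewrite eqEcard; apply/andP; split.
      by apply/subsetP => _ /imsetP[i _ ->]; rewrite ffunE; have /setIP[] := fin i.
    rewrite card_imset ?cardsT ?card_ord ?(card_hyperedge eH) //.
    by move=> i j; rewrite !ffunE => /fI.
  exists [set t i | i in setT]; rewrite inE tH; apply/forallP => i.
  apply/cards1P; exists (t i); apply/setP => u; rewrite !inE.
  apply/andP/eqP => [[/imsetP[j _ ->] tj]|->].
    by rewrite (disjoint_boxP D (tA j) tj).
  by split; first exact: imset_f.
rewrite /valid_query negb_and => /orP[/forallPn[i]|]; last first.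
  by rewrite /disjoint_box => /negPf ->.
rewrite negbK => /eqP Ai; apply/esym/negbTE; rewrite negb_and orbC.
apply/orP; left; apply/existsPn => t; rewrite negb_and orbC.
by apply/orP; left; apply/forallPn; exists i; rewrite Ai inE.
Qed.

Lemma ordered_edge_inj H t : ordered_edge H t -> injective t.
Proof. by case/andP => /injectiveP. Qed.

Lemma card_orderings H e : e \in hyperedges H ->
  #|[set t | ordered_edge H t && ([set t i | i in setT] == e)]| = d`!.
Proof.
move=> eH; have := @card_inj_ffuns_on 'I_d U (mem e).
rewrite card_ord (card_hyperedge eH) ffactnn => <-.
apply: eq_card => t; rewrite !inE /ordered_edge andbC; apply/andP/andP.
  move=> [/eqP te /andP[tI _]]; split=> //; apply/ffun_onP => i.
  by rewrite -te imset_f.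
move=> [/ffun_onP tin /injectiveP tI].
have te : [set t i | i in setT] = e.
  apply/eqP; rewrite eqEcard card_imset // cardsT card_ord (card_hyperedge eH).
  by rewrite leqnn andbT; apply/subsetP => _ /imsetP[i _ ->]; exact: tin.
by rewrite te eH eqxx; split=> //; rewrite andbT; apply/injectiveP.
Qed.

Lemma card_ordered_edges H :
  #|[set t | ordered_edge H t]| = (d`! * num_hyperedges H)%N.
Proof.
rewrite -sum1_card (partition_big (fun t : {ffun 'I_d -> U} => [set t i | i in setT])
  (fun e => e \in hyperedges H)) /=; last by move=> t; rewrite inE => /andP[].
rewrite (eq_bigr (fun=> d`!)) => [|e eH]; first by rewrite sum_nat_const mulnC.
rewrite sum1dep_card -(card_orderings eH); apply: eq_card => t.
by rewrite !inE.
Qed.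

End OrderedEdges.

(** * Resampling maps and rainbow colourings *)

Section Numeric.
Variable R : realFieldType.

(** Stands in for the bound by exp (- n x); at x = 1 / D and n = D it gives the factor 1/2 of
    [expr_one_minus_inv]. *)
Lemma expr_one_minus_le (x : R) n : 0 <= x <= 1 -> (1 - x) ^+ n * (1 + n%:R * x) <= 1.
Proof.
move=> /andP[x0 x1]; elim: n => [|n IH]; first by rewrite mul1r mul0r addr0.
apply: le_trans IH; rewrite exprSr -mulrA ler_wpM2l ?exprn_ge0 ?subr_ge0 //.
have : 0 <= x ^+ 2 * n.+1%:R by rewrite mulr_ge0 ?exprn_ge0.
by rewrite -!natr1; nra.
Qed.

Lemma expr_one_minus_inv (D : nat) : (0 < D)%N ->
  (1 - D%:R^-1) ^+ D <= 2^-1 :> R.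
Proof.
move=> D0; have D0' : D%:R != 0 :> R by rewrite pnatr_eq0 -lt0n.
have := @expr_one_minus_le D%:R^-1 D; rewrite divff //.
rewrite invr_ge0 ler0n invf_le1 ?ltr0n // ler1n D0 => /(_ isT); lra.
Qed.

Lemma expr_one_plus_le (y : R) n : 0 <= y -> 2 * n%:R * y <= 1 ->
  (1 + y) ^+ n <= 1 + 2 * n%:R * y.
Proof.
move=> y0; elim: n => [|n IH] ny; first by rewrite mulr0 mul0r addr0.
have ny' : 2 * n%:R * y <= 1.
  by apply: le_trans ny; rewrite ler_wpM2r // ler_wpM2l // ler_nat.
rewrite exprSr; apply: (@le_trans _ _ ((1 + 2 * n%:R * y) * (1 + y))).
  by rewrite ler_wpM2r ?IH // addr_ge0.
rewrite -natr1; nra.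
Qed.

End Numeric.

(** Blocks of lengths [k i] are laid end to end along 'I_M, by enumerating the pairs (i, y) with y <
    k i; the rest of 'I_M goes to [i0]. *)
Lemma exists_fibres (I : finType) (i0 : I) (k : I -> nat) M :
  (\sum_i k i <= M)%N ->
  exists f : {ffun 'I_M -> I}, forall i, (k i <= #|[set x | f x == i]|)%N.
Proof.
move=> kM; pose T : finType := {i : I & 'I_(k i)}%type.
have cT : #|T| = (\sum_i k i)%N.
  by rewrite card_tagged sumnE big_map big_enum; apply: eq_bigr => i _; rewrite card_ord.
have TM : (#|T| <= M)%N by rewrite cT.
pose f (x : 'I_M) : I :=
  if insub (x : nat) is Some y then tag (enum_val (y : 'I_#|T|)) else i0.
exists (finfun f) => i.
pose g (y : 'I_(k i)) : 'I_M := widen_ord TM (enum_rank (Tagged (fun i => 'I_(k i)) y)).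
have gI : injective g.
  move=> y z /(congr1 val) /= /val_inj /enum_rank_inj /eqP.
  by rewrite eq_Tagged => /eqP.
rewrite -{1}(card_ord (k i)) -(card_imset _ gI); apply: subset_leq_card.
apply/subsetP => _ /imsetP[y _ ->]; rewrite inE ffunE /f /g /=.
case: insubP => [z _ zE|]; last by rewrite ltn_ord.
have -> : z = enum_rank (Tagged (fun i => 'I_(k i)) y) by exact: val_inj.
by rewrite enum_rankK.
Qed.

Lemma sum_fibres (I : finType) M (f : {ffun 'I_M -> I}) :
  (\sum_i #|[set x | f x == i]|)%N = M.
Proof.
rewrite -[RHS]card_ord -sum1_card (partition_big f predT) //=.
by apply: eq_bigr => i _; rewrite sum1dep_card; apply: eq_card => x; rewrite !inE.
Qed.

Lemma exists_exact_fibres (I : finType) (i0 : I) (k : I -> nat) M :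
  (\sum_i k i)%N = M ->
  exists f : {ffun 'I_M -> I}, forall i, #|[set x | f x == i]| = k i.
Proof.
move=> kM; have [f Hf] := @exists_fibres I i0 k M (eq_leq kM).
exists f => i; have := leqif_sum (P := predT) (fun i _ => leqif_eq (Hf i)).
rewrite kM sum_fibres => -[_]; rewrite eqxx => /esym/forall_inP/(_ i isT)/eqP ->.
by [].
Qed.

Section Resampling.
Variables (R : realType) (I : finType) (M : nat).
Hypotheses (i0 : I) (MI : (2 * #|I| <= M)%N).

(** Nonnegativity is asked for under the existential, so that a map can be chosen for every [a]. *)
Lemma exists_resampling (a : {ffun I -> R}) :
  exists f : {ffun 'I_M -> I}, (forall i, 0 <= a i) ->
    forall i, a i * M%:R <= 2 * (\sum_j a j) * #|[set x | f x == i]|%:R.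
Proof.
have [a0|] := boolP [forall i, 0 <= a i]; last first.
  by move=> na; exists [ffun=> i0] => a0; case/forallP: na.
move/forallP in a0; set A := \sum_j a j.
have A0 : 0 <= A by apply: sumr_ge0.
have [Az|Anz] := eqVneq A 0.
  exists [ffun=> i0] => _ i; have : a i <= A.
    by rewrite /A (bigD1 i) //= lerDl sumr_ge0.
  rewrite Az => ai; have -> : a i = 0 by apply/eqP; rewrite eq_le ai a0.
  by rewrite !(mul0r, mulr0).
(* Rounding down and adding 1 covers the share of i and keeps its fibre nonempty. The #|I| added
   units fit because shares are taken of M - #|I|; this is at least M / 2, whence the factor 2. *)
pose k i := (Num.truncn ((M - #|I|)%:R * (a i / A))).+1.
have Apos : 0 < A by rewrite lt_def Anz.
have IM : (#|I| <= M)%N by lia.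
have kE i : (M - #|I|)%:R * (a i / A) < (k i)%:R :> R.
  have /truncn_itv/andP[] // : 0 <= (M - #|I|)%:R * (a i / A).
  by rewrite mulr_ge0 ?divr_ge0 ?ler0n.
have kM : (\sum_i k i <= M)%N.
  rewrite /k; under eq_bigr do rewrite -addn1.
  rewrite big_split /= sum_nat_const muln1.
  rewrite -[leqRHS](subnK IM) leq_add2r.
  rewrite -(ler_nat R) natr_sum.
  apply: (@le_trans _ _ (\sum_i (M - #|I|)%:R * (a i / A))).
    by apply: ler_sum => i _; rewrite truncn_le mulr_ge0 ?divr_ge0 ?ler0n.
  by rewrite -mulr_sumr -mulr_suml divff // mulr1.
have [f Hf] := exists_fibres i0 kM.
exists f => _ i; have := ltW (kE i); rewrite mulrA ler_pdivrMr // => le1.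
have le2 : (k i)%:R * A <= A * #|[set x | f x == i]|%:R.
  by rewrite mulrC ler_wpM2l // ler_nat.
have le3 : a i * M%:R <= 2 * ((M - #|I|)%:R * a i).
  rewrite mulrA mulrC ler_wpM2r // -natrM ler_nat. lia.
apply: (le_trans le3); rewrite -mulrA ler_wpM2l //; exact: le_trans le1 le2.
Qed.

End Resampling.

(** * Colourings that are rainbow, in the right order, on every injective tuple *)

Section HashFamily.
Variables (U : finType) (d L : nat).
Hypotheses (d0 : (0 < d)%N) (UL : (#|U| <= 2 ^ L)%N).

Definition colouring := {ffun U -> 'I_d}.

(** One random colouring suits a given tuple with probability d ^ -d, so d ^ d of them all fail with
    probability at most 1/2; L d + 1 such batches beat the at most 2 ^ (L d) tuples. *)
Definition hash_size := (d ^ d * (L * d + 1))%N.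

Lemma Ex_rainbow (R : realFieldType) (tau : {ffun 'I_d -> U}) : injective tau ->
  Ex (fun chi : colouring => [forall i, chi (tau i) == i]%:R) = (d ^ d)%:R^-1 :> R.
Proof.
move=> tauI.
have card_d : (0 < #|'I_d|)%N by rewrite card_ord.
(* Stated vertex by vertex, the event is a conjunction of independent conditions on the colours. *)
transitivity (Ex (fun chi : colouring =>
  [forall u, [forall i, (tau i == u) ==> (chi u == i)]]%:R) : R).
  apply: eq_Ex => chi; congr (nat_of_bool _)%:R; apply/forallP/forallP => H x.
    by apply/forallP => i; apply/implyP => /eqP <-; exact: H.
  by have /forallP/(_ x) := H (tau x); rewrite eqxx.
rewrite (Ex_forall_ffun R (fun u c => [forall i, (tau i == u) ==> (c == i)])).
transitivity (\prod_(u : U) (if u \in [set tau i | i in setT] then d%:R^-1 else 1) : R).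
  apply: eq_bigr => u _; case: ifP => [/imsetP[i _ ->]|utau]; last first.
    rewrite -[RHS](Ex_cst card_d 1); apply: eq_Ex => c.
    rewrite (_ : [forall _, _] = true) //; apply/forallP => i.
    by apply/implyP => /eqP iu; rewrite -iu imset_f in utau.
  rewrite /Ex card_ord (eq_bigr (fun c => (c == i)%:R)).
    by rewrite (bigD1 i) //= eqxx big1 ?addr0 ?mul1r // => c /negPf ->.
  move=> c _; congr (nat_of_bool _)%:R; apply/forallP/idP => [/(_ i)|/eqP -> j].
    by rewrite eqxx.
  by apply/implyP => /eqP/tauI ->.
rewrite -big_mkcond prodr_const card_imset // cardsT card_ord.
by rewrite exprVn natrX.
Qed.

Lemma exists_hash_family :
  exists chi : {ffun 'I_hash_size -> colouring},
    forall tau : {ffun 'I_d -> U}, injective tau ->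
      exists k, forall i, chi k (tau i) = i.
Proof.
pose Y : finType := {ffun 'I_hash_size -> colouring}.
pose bad (tau : {ffun 'I_d -> U}) (chi : Y) :=
  [forall k, ~~ [forall i, chi k (tau i) == i]].
have card_chi : (0 < #|{: colouring}|)%N.
  by rewrite card_ffun card_ord expn_gt0 d0.
have card_Y : (0 < #|Y|)%N by rewrite card_ffun expn_gt0 card_chi.
have badP (tau : {ffun _ -> _}) : injectiveb tau ->
    Ex (fun chi => (bad tau chi)%:R) <= (2 ^+ (L * d + 1))^-1 :> rat.
  move=> /injectiveP tauI; rewrite /bad.
  rewrite (Ex_forall_ffun _ (fun _ (c : colouring) => ~~ [forall i, c (tau i) == i])).
  rewrite prodr_const card_ord Ex_compl // Ex_rainbow //.
  rewrite -exprVn exprM lerXn2r ?nnegrE ?invr_ge0 //.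
    rewrite exprn_ge0 // subr_ge0 invf_le1 ?ltr0n ?ler1n ?expn_gt0 ?d0 //.
  by apply: expr_one_minus_inv; rewrite expn_gt0 d0.
have := union_bound badP => ub.
have [chi Hchi] : exists chi : Y, ~~ [exists tau : {ffun _ -> _}, injectiveb tau && bad tau chi].
  apply/existsP; rewrite -negb_forall; apply/negP => /forallP all_bad.
  move: ub; rewrite (eq_Ex (g := fun=> 1)) => [|chi]; last by rewrite all_bad.
  rewrite Ex_cst // leNgt => /negP; apply.
  have : (#|[pred tau : {ffun 'I_d -> U} | injectiveb tau]|%:R <= 2 ^+ (L * d) :> rat).
    rewrite -natrX ler_nat expnM; apply: leq_trans (max_card _) _.
    by rewrite card_ffun card_ord leq_exp2r.
  rewrite exprD expr1 invfM => le; rewrite mulrA.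
  have : #|[pred tau : {ffun 'I_d -> U} | injectiveb tau]|%:R / 2 ^+ (L * d) <= 1 :> rat.
    by rewrite ler_pdivrMr ?exprn_gt0 // mul1r.
  by set z := _ / _; lra.
exists chi => tau /injectiveP tauI.
move/existsPn: Hchi => /(_ tau); rewrite tauI /= => /forallPn[k].
by rewrite negbK => /forallP H; exists k => i; apply/eqP.
Qed.

End HashFamily.

(** * Thinning *)

Lemma exists_large_class n (S : 'I_n.+1 -> nat) :
  exists k, (\sum_i S i <= n.+1 * S k)%N.
Proof.
case: (@arg_maxnP _ ord0 predT S isT) => k _ max_k; exists k.
apply: (@leq_trans (\sum_(i < n.+1) S k)); first by apply: leq_sum => i _; exact: max_k.
by rewrite sum_nat_const card_ord.
Qed.

Section Thinning.
Variables (R : realFieldType) (U : finType) (L : nat).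

(** One uniform number per vertex serves all rates through a threshold, so the seed does not depend
    on the exponents. *)
Definition thinning := {ffun U -> 'I_(2 ^ L)}.

(* Keeps each vertex independently with probability 2 ^ -j. *)
Definition thinned (s : thinning) (j : nat) : {set U} :=
  [set u | (s u * 2 ^ j < 2 ^ L)%N].

Definition thinned_box d (s : {ffun 'I_d -> thinning}) (j : {ffun 'I_d -> 'I_L.+1})
  : {ffun 'I_d -> {set U}} := [ffun i => thinned (s i) (j i)].

Lemma thinned_boxE d (s : {ffun 'I_d -> thinning}) j i :
  thinned_box s j i = thinned (s i) (j i).
Proof. by rewrite ffunE. Qed.

(* 2 ^ r is a guess for the number of tuples in h. *)
Definition hit d (h : pred {ffun 'I_d -> U}) (r : nat) (s : {ffun 'I_d -> thinning})
  : bool :=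
  [exists j : {ffun 'I_d -> 'I_L.+1}, (\sum_i j i == r)%N &&
     [exists t, h t && in_box t (thinned_box s j)]].

Lemma card_thinning_gt0 : (0 < #|{: thinning}|)%N.
Proof. by rewrite card_ffun card_ord !expn_gt0. Qed.

Lemma Ex_coin (j : nat) : (j <= L)%N ->
  Ex (fun x : 'I_(2 ^ L) => (x * 2 ^ j < 2 ^ L)%N%:R) = (2 ^+ j)^-1 :> R.
Proof.
move=> jL; have le2 : (2 ^ (L - j) <= 2 ^ L)%N by rewrite leq_exp2l // leq_subr.
rewrite /Ex card_ord.
have -> : \sum_(x < 2 ^ L) (x * 2 ^ j < 2 ^ L)%N%:R = 2 ^+ (L - j) :> R.
  rewrite (eq_bigr (fun x : 'I_(2 ^ L) => if (x < 2 ^ (L - j))%N then 1 else 0)).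
    rewrite -big_mkcond (big_ord_narrow le2) sumr_const card_ord.
    by rewrite -natrX.
  move=> x _; rewrite -{2}(subnK jL) expnD ltn_pmul2r ?expn_gt0 //.
  by case: (_ < _)%N.
by rewrite natrX -{2}(subnK jL) exprD invfM mulrA divff ?mul1r // expf_neq0 ?pnatr_eq0.
Qed.

Lemma Ex_in_thinned (u : U) (j : nat) : (j <= L)%N ->
  Ex (fun s => (u \in thinned s j)%:R) = (2 ^+ j)^-1 :> R.
Proof.
move=> jL; rewrite -(Ex_coin jL).
rewrite -(Ex_ffun_at u (fun x : 'I_(2 ^ L) => (x * 2 ^ j < 2 ^ L)%N%:R)).
  by apply: eq_Ex => s; rewrite inE.
by rewrite card_ord expn_gt0.
Qed.

(** All exponents but the first are free, and the prescribed sum determines that one. This saves a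
    factor L + 1 in the coarse distortion. *)
Lemma card_exponents d r :
  (#|[pred j : {ffun 'I_d.+1 -> 'I_L.+1} | (\sum_i j i == r)%N]| <= L.+1 ^ d)%N.
Proof.
rewrite -sum1_card big_mkcond big_fcons exchange_big /=.
have -> : (L.+1 ^ d = #|{: {ffun 'I_d -> 'I_L.+1}}|)%N by rewrite card_ffun !card_ord.
rewrite -[leqRHS]sum1_card.
apply: leq_sum => j _; set m := (\sum_i j i)%N.
rewrite (eq_bigr (fun y : 'I_L.+1 => nat_of_bool (y + m == r)%N)); last first.
  move=> y _; rewrite inE big_ord_recl fcons0.
  by rewrite (eq_bigr (fun i => nat_of_ord (j i))) => [|i _]; rewrite ?fconsS //; case: eqP.
have [[y /eqP ym]|none] := pselect (exists y : 'I_L.+1, (y + m == r)%N).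
  rewrite (bigD1 y) //= -{1}ym eqxx big1 // => z /negPf zy.
  by rewrite -ym eqn_add2r val_eqE zy.
by rewrite big1 // => y _; case: eqP => // /eqP e; case: none; exists y.
Qed.

Lemma Ex_in_thinned_box d (t : {ffun 'I_d -> U}) (j : {ffun 'I_d -> 'I_L.+1}) :
  Ex (fun s => (in_box t (thinned_box s j))%:R) = (2 ^+ (\sum_i j i)%N)^-1 :> R.
Proof.
transitivity (Ex (fun s : {ffun 'I_d -> thinning} =>
    [forall i, t i \in thinned (s i) (j i)]%:R : R)).
  apply: eq_Ex => s; congr (nat_of_bool _)%:R; apply: eq_forallb => i.
  by rewrite ffunE.
rewrite (Ex_forall_ffun R (fun i (x : thinning) => t i \in thinned x (j i))).
rewrite -exprVn -prodrXr; apply: eq_bigr => i _.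
by rewrite Ex_in_thinned ?exprVn // -ltnS.
Qed.

Lemma hit_le d (h : pred {ffun 'I_d.+1 -> U}) r :
  Ex (fun s => (hit h r s)%:R) <= (L.+1 ^ d * #|h|)%:R / 2 ^+ r :> R.
Proof.
pose I : finType := ({ffun 'I_d.+1 -> 'I_L.+1} * {ffun 'I_d.+1 -> U})%type.
pose P := [pred p : I | (\sum_i p.1 i == r)%N && h p.2].
have bnd (p : I) : P p ->
    Ex (fun s => (in_box p.2 (thinned_box s p.1))%:R) <= (2 ^+ r)^-1 :> R.
  by move=> /andP[/eqP <- _]; rewrite Ex_in_thinned_box.
apply: le_trans (le_trans (union_bound bnd) _).
  apply: le_Ex => s; rewrite ler_nat; have [|//] := boolP (hit h r s).
  move=> /existsP[j /andP[jr /existsP[t /andP[ht tj]]]].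
  by rewrite lt0b; apply/existsP; exists (j, t); rewrite /= jr ht tj.
rewrite ler_wpM2r ?invr_ge0 ?exprn_ge0 // ler_nat.
have -> : #|P| = (#|[pred j : {ffun 'I_d.+1 -> 'I_L.+1} | (\sum_i j i == r)%N]| * #|h|)%N.
  by rewrite -cardX; apply: eq_card => -[j t]; rewrite !inE.
by rewrite leq_mul2r card_exponents orbT.
Qed.

Lemma hit0 d (h : pred {ffun 'I_d -> U}) s : (0 < #|h|)%N -> hit h 0 s.
Proof.
move=> /card_gt0P[t ht]; apply/existsP; exists [ffun=> ord0].
rewrite big1 ?eqxx /= => [|i _]; last by rewrite ffunE.
apply/existsP; exists t; rewrite -topredE /= in ht; rewrite ht /=.
by apply/in_boxP => i; rewrite !ffunE inE muln1 ltn_ord.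
Qed.

Hypothesis UL : (#|U| <= 2 ^ L)%N.

(** For j > 0 every vertex of the class is lost with probability at most (1 - 2 ^ -j) ^ (B 2 ^ j) <=
    2 ^ -B. At j = 0 nothing is lost, so any nonempty class will do. *)
Lemma miss_class (V : {set U}) (j B : nat) : (0 < #|V|)%N ->
  (j <= L)%N -> (j == 0%N) || (B * 2 ^ j <= #|V|)%N ->
  Ex (fun s => [forall u, (u \in V) ==> (u \notin thinned s j)]%:R) <= (2 ^+ B)^-1 :> R.
Proof.
move=> V0 jL jV.
rewrite (eq_Ex (g := fun s : thinning => [forall u, (u \in V) ==>
   ~~ (s u * 2 ^ j < 2 ^ L)%N]%:R)); last first.
  by move=> s; congr (nat_of_bool _)%:R; apply: eq_forallb => u; rewrite inE.
rewrite (Ex_forall_ffun R (fun u (x : 'I_(2 ^ L)) => (u \in V) ==> ~~ (x * 2 ^ j < 2 ^ L)%N)).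
have card0 : (0 < #|'I_(2 ^ L)|)%N by rewrite card_ord expn_gt0.
have -> : \prod_(u : U) Ex (fun x : 'I_(2 ^ L) =>
    ((u \in V) ==> ~~ (x * 2 ^ j < 2 ^ L)%N)%:R) = (1 - (2 ^+ j)^-1) ^+ #|V| :> R.
  rewrite -prodr_const [RHS]big_mkcond; apply: eq_bigr => u _.
  case: (u \in V); last exact: Ex_cst.
  by rewrite (Ex_compl R card0) Ex_coin.
have inv01 : 0 <= ((2 ^+ j)^-1 : R) <= 1.
  by rewrite invr_ge0 exprn_ge0 //= invf_le1 ?exprn_gt0 // exprn_ege1 // ler1n.
have /andP[i0 i1] := inv01.
have [->|jn0] := eqVneq j 0%N.
  by rewrite expr0 invr1 subrr expr0n eqn0Ngt V0 invr_ge0 exprn_ge0.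
rewrite (negPf jn0) /= in jV.
apply: (@le_trans _ _ ((1 - (2 ^+ j)^-1) ^+ (B * 2 ^ j))).
  by rewrite ler_wiXn2l // ?subr_ge0 // gerBl.
rewrite mulnC exprM -[leRHS]exprVn lerXn2r ?nnegrE ?invr_ge0 //.
  by rewrite exprn_ge0 // subr_ge0.
by have := @expr_one_minus_inv R (2 ^ j); rewrite natrX expn_gt0; apply.
Qed.

(* Induction on d: some dyadic degree class V of the first coordinate carries a
   1 / (L d + 1) fraction of h; thin it at a rate keeping about B vertices of V,
   and use the remaining exponent on the link of a survivor. *)
Lemma hit_ge d (h : pred {ffun 'I_d -> U}) (B W r : nat) :
  (0 < B)%N -> (4 * B * (L * d + 1) <= W)%N -> (0 < #|h|)%N ->
  (r == 0%N) || (2 ^ r * W ^ d <= #|h|)%N ->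
  Ex (fun s => (~~ hit h r s)%:R) <= d%:R * (2 ^+ B)^-1 :> R.
Proof.
move=> B0; elim: d h r => [|d IH] h r BW h0 hr.
  (* A 0-ary [h] has at most one tuple, so only the guess r = 0 is possible. *)
  have -> : r = 0%N.
    case/orP: hr => [/eqP //|]; have := max_card h.
    rewrite card_ffun card_ord expn0 muln1 => le1 /leq_trans/(_ le1).
    by case: r => // r; rewrite leqNgt -(expn0 2) ltn_exp2l.
  rewrite (eq_Ex (g := fun=> 0)) => [|s]; last by rewrite hit0.
  by rewrite mul0r /Ex big1 ?mul0r.
have IB0 : 0 <= (2 ^+ B)^-1 :> R by rewrite invr_ge0 exprn_ge0.
have [r0|rn0] := eqVneq r 0%N.
  rewrite (eq_Ex (g := fun=> 0)) => [|s]; last by rewrite r0 hit0.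
  by rewrite /Ex big1 ?mul0r ?mulr_ge0.
rewrite (negPf rn0) /= in hr.
pose hu u : pred {ffun 'I_d -> U} := fun t => h (fcons u t).
pose a u := #|hu u|.
have ha : #|h| = (\sum_u a u)%N.
  rewrite -sum1_card big_mkcond big_fcons; apply: eq_bigr => u _.
  by rewrite -big_mkcond sum1_card.
have a_le u : (a u <= 2 ^ (L * d))%N.
  apply: leq_trans (max_card _) _; rewrite card_ffun card_ord expnM.
  by case: (d) => // d'; rewrite leq_exp2r.
pose V k := [set u | (0 < a u)%N && (trunc_log 2 (a u) == k)].
have a_ge k u : u \in V k -> (2 ^ k <= a u)%N.
  by rewrite inE => /andP[a0 /eqP <-]; exact: trunc_logP.
have a_lt k u : u \in V k -> (a u <= 2 ^ k.+1)%N.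
  by rewrite inE => /andP[a0 /eqP <-]; exact/ltnW/trunc_log_ltn.
have hV : #|h| = (\sum_(k < (L * d).+1) \sum_(u in V k) a u)%N.
  rewrite ha (bigID (fun u => 0 < a u)%N) /= [X in (_ + X)%N]big1 ?addn0; last first.
    by move=> u; rewrite lt0n negbK => /eqP.
  have inordK_ u : (inord (trunc_log 2 (a u)) : 'I_(L * d).+1) = trunc_log 2 (a u) :> nat.
    apply: inordK; rewrite ltnS -(leq_exp2l (m := 2)) //.
    have [a0|a0] := posnP (a u); first by rewrite a0 trunc_log0 expn_gt0.
    by apply: leq_trans (a_le u); exact: trunc_logP.
  rewrite (partition_big (fun u => inord (trunc_log 2 (a u)) : 'I_(L * d).+1) predT) //=.
  apply: eq_bigr => k _; apply: eq_bigl => u; rewrite inE.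
  by rewrite -val_eqE /= inordK_.
have [k hk] := exists_large_class (fun k : 'I_(L * d).+1 => (\sum_(u in V k) a u)%N).
rewrite -hV in hk; set Vk := V k in hk.
have {}hk : (#|h| <= (L * d).+1 * (#|Vk| * 2 ^ k.+1))%N.
  apply: leq_trans hk _; rewrite leq_mul2l /=.
  by rewrite -sum_nat_const; apply: leq_sum => u; exact: a_lt.
have V0 : (0 < #|Vk|)%N.
  by rewrite lt0n; apply: contraTneq hk => ->; rewrite mul0n muln0 -ltnNge.
(* [j0] will be the strongest thinning within the budget r that keeps B vertices of the class on
   average; 0 is allowed whatever the size of the class. *)
pose Pj j := (j <= r)%N && ((j == 0%N) || (B * 2 ^ j <= #|Vk|)%N).
have exPj : exists j, Pj j by exists 0%N.
have ubPj j : Pj j -> (j <= r)%N by case/andP.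
case: (ex_maxnP exPj ubPj) => j0 /andP[j0r j0V] j0max.
have j0L : (j0 <= L)%N.
  case/orP: j0V => [/eqP -> //|le1]; rewrite -(leq_exp2l (m := 2)) //.
  apply: leq_trans UL; apply: leq_trans (max_card (mem Vk)).
  by apply: leq_trans le1; rewrite leq_pmull.
have W0 : (0 < W)%N by lia.
have BWd : (4 * B * (L * d + 1) <= W)%N.
  apply: leq_trans BW; rewrite leq_mul2l; apply/orP; right.
  by rewrite leq_add2r leq_mul2l leqnSn orbT.
(* If budget remains, maximality of [j0] gives #|Vk| < 2 B 2 ^ j0. With L d + 1 classes and links of
   size at most 2 ^ k.+1, #|h| is at most 4 B (L d + 1) 2 ^ j0 2 ^ k: the two dyadic roundings make
   the 4 in the bound on W, and one factor W pays for this coordinate. *)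
have r'P u : u \in Vk -> ((r - j0)%N == 0%N) || (2 ^ (r - j0) * W ^ d <= a u)%N.
  move=> uV; rewrite subn_eq0; case: leqP => //= j0_lt.
  have Vlt : (#|Vk| < B * 2 ^ j0.+1)%N.
    rewrite ltnNge; apply/negP => le1; have := j0max j0.+1.
    by rewrite /Pj j0_lt le1 orbT => /(_ isT); rewrite ltnn.
  apply: leq_trans (a_ge _ _ uV).
  rewrite -(leq_pmul2l (m := W * 2 ^ j0)) ?muln_gt0 ?W0 ?expn_gt0 //.
  have -> : (W * 2 ^ j0 * (2 ^ (r - j0) * W ^ d) = 2 ^ r * W ^ d.+1)%N.
    by rewrite -{2}(subnKC (ltnW j0_lt)) expnD expnS; ring.
  apply: leq_trans hr _; apply: leq_trans hk _.
  apply: (@leq_trans ((L * d).+1 * (B * 2 ^ j0.+1 * 2 ^ k.+1))%N).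
    by rewrite leq_mul2l leq_mul2r (ltnW Vlt) !orbT.
  rewrite !expnS; have -> : ((L * d).+1 * (B * (2 * 2 ^ j0) * (2 * 2 ^ k)) =
    4 * B * (L * d + 1) * (2 ^ j0 * 2 ^ k))%N by ring.
  by rewrite -[leqRHS]mulnA leq_mul2r BWd orbT.
rewrite Ex_fcons.
(* Either the class is wiped out, or some u survives and the other coordinates, thinned
   independently, have to hit its link with the remaining exponent. *)
have step (s0 : thinning) : Ex (fun s => (~~ hit h r (fcons s0 s))%:R) <=
    [forall u, (u \in Vk) ==> (u \notin thinned s0 j0)]%:R + d%:R * (2 ^+ B)^-1 :> R.
  case: (boolP [forall u, _]) => [_|/forallPn[u]].
    have card0 : (0 < #|{: {ffun 'I_d -> thinning}}|)%N.
      by rewrite card_ffun expn_gt0 card_thinning_gt0.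
    apply: (@le_trans _ _ 1); last by rewrite lerDl mulr_ge0.
    by apply: Ex_le_cst => // s; case: (~~ _).
  rewrite negb_imply negbK => /andP[uV us]; rewrite add0r.
  apply: le_trans (IH (hu u) (r - j0)%N BWd _ (r'P u uV)); last first.
    by apply: leq_trans (a_ge _ _ uV); rewrite expn_gt0.
  apply: le_Ex => s; rewrite ler_nat; case: (boolP (hit (hu u) _ s)) => [hs|_]; last first.
    by case: (~~ _).
  suff -> : hit h r (fcons s0 s) by [].
  case/existsP: hs => j /andP[/eqP jr /existsP[t /andP[ht /in_boxP tj]]].
  apply/existsP; exists (fcons (inord j0) j).
  rewrite big_ord_recl fcons0 inordK ?ltnS //.
  under eq_bigr do rewrite fconsS.
  rewrite jr subnKC // eqxx /=; apply/existsP; exists (fcons u t); apply/andP; split; first exact: ht.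
  apply/in_boxP => i; case: (unliftP ord0 i) => [i' ->|->].
    by have := tj i'; rewrite !thinned_boxE !fconsS.
  by rewrite thinned_boxE !fcons0 inordK ?ltnS.
apply: le_trans (le_Ex step) _; rewrite ExD Ex_cst ?card_thinning_gt0 //.
by rewrite -[d.+1%:R]natr1 mulrDl mul1r addrC lerD2l; exact: miss_class.
Qed.

End Thinning.

(** * Dyadic boxes and coarse counting *)

Section BoxTree.
Variables (U : finType) (d : nat).
Local Notation box := {ffun 'I_d -> {set U}}.
Implicit Types (B : box) (t : {ffun 'I_d -> U}) (h : pred {ffun 'I_d -> U}).

Definition box_count h B : nat := #|[pred t | h t && in_box t B]|.

Definition bit_set (l : nat) : {set U} := [set u | odd (enum_rank u %/ 2 ^ l)].

(** The same bit splits all d coordinates at once, so a box has 2 ^ d children and L levels isolate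
    a tuple. Coordinates of a tree box may overlap. *)
Definition subbox (l : nat) B (s : {ffun 'I_d -> bool}) : box :=
  [ffun i => [set u in B i | (u \in bit_set l) == s i]].

Definition full_box : box := [ffun=> setT].

Fixpoint level_boxes (l : nat) : {set box} :=
  if l is l'.+1 then
    [set subbox l' p.1 p.2 | p in setX (level_boxes l') [set: {ffun 'I_d -> bool}]]
  else [set full_box].

Definition boxes_below n : {set box} := \bigcup_(l < n) level_boxes l.

Lemma level_boxesS l B s : B \in level_boxes l -> subbox l B s \in level_boxes l.+1.
Proof.
move=> BL; apply/imsetP; exists (B, s) => //.
by rewrite in_setX BL in_setT.
Qed.

Lemma boxes_belowP n l B : (l < n)%N -> B \in level_boxes l -> B \in boxes_below n.
Proof. by move=> ln Bl; apply/bigcupP; exists (Ordinal ln). Qed.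

Lemma card_level_boxes l : (#|level_boxes l| <= 2 ^ (d * l))%N.
Proof.
elim: l => [|l IH] /=; first by rewrite cards1 muln0.
apply: leq_trans (leq_imset_card _ _) _; rewrite cardsX cardsT card_ffun card_bool card_ord.
by rewrite mulnS expnD mulnC leq_mul2l IH orbT.
Qed.

Lemma card_boxes_below n : (#|boxes_below n.+1| <= n.+1 * 2 ^ (d * n))%N.
Proof.
apply: (@leq_trans (\sum_(l < n.+1) #|level_boxes l|)).
  rewrite /boxes_below; apply: (big_ind2 (fun (A : {set box}) m => #|A| <= m)%N).
  - by rewrite cards0.
  - move=> A m A' m' le le'; apply: leq_trans (leq_card_setU _ _) _.
    exact: leq_add.
  - by [].
apply: (@leq_trans (\sum_(l < n.+1) 2 ^ (d * n))); last first.
  by rewrite sum_nat_const card_ord.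
apply: leq_sum => l _; apply: leq_trans (card_level_boxes l) _.
by rewrite leq_exp2l // leq_mul2l -ltnS ltn_ord orbT.
Qed.

Lemma in_subbox l B s t :
  in_box t (subbox l B s) = in_box t B && ([ffun i => t i \in bit_set l] == s).
Proof.
apply/in_boxP/andP => [H|[/in_boxP tB /eqP <-] i].
  split; first by apply/in_boxP => i; have := H i; rewrite ffunE inE => /andP[].
  by apply/eqP/ffunP => i; have := H i; rewrite !ffunE inE => /andP[_ /eqP].
by rewrite !ffunE inE tB eqxx.
Qed.

Lemma box_count_split h l B :
  box_count h B = (\sum_s box_count h (subbox l B s))%N.
Proof.
rewrite /box_count -sum1_card.
rewrite (partition_big (fun t => [ffun i => t i \in bit_set l]) predT) //=.
apply: eq_bigr => s _; rewrite -sum1_card; apply: eq_bigl => t.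
by rewrite !inE in_subbox andbA.
Qed.

Lemma full_box_count h : box_count h full_box = #|h|.
Proof.
apply: eq_card => t; rewrite !inE (_ : in_box t full_box) ?andbT //.
by apply/in_boxP => i; rewrite ffunE inE.
Qed.

Lemma level_boxes_bits l B i u v k : B \in level_boxes l ->
  u \in B i -> v \in B i -> (k < l)%N -> (u \in bit_set k) = (v \in bit_set k).
Proof.
elim: l B => // l IH _ /imsetP[[B s] /setXP[/= BL _] ->].
rewrite ffunE inE => /andP[uB /eqP us]; rewrite inE => /andP[vB /eqP vs].
rewrite ltnS leq_eqVlt => /orP[/eqP ->|]; first by rewrite us vs.
exact: IH BL uB vB.
Qed.

Lemma eq_from_bits L a b : (a < 2 ^ L)%N -> (b < 2 ^ L)%N ->
  (forall k, (k < L)%N -> odd (a %/ 2 ^ k) = odd (b %/ 2 ^ k)) -> a = b.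
Proof.
elim: L a b => [|L IH] a b; first by rewrite expn0; case: a => //; case: b.
move=> aL bL ab; rewrite -(odd_double_half a) -(odd_double_half b).
have := ab 0%N; rewrite !divn1 => -> //; congr (_ + _.*2)%N; apply: IH.
- by rewrite -divn2 ltn_divLR // -expnSr.
- by rewrite -divn2 ltn_divLR // -expnSr.
- by move=> k kL; rewrite -!divn2 -!divnMA -expnS; exact: ab.
Qed.

Section Leaves.
Variable L : nat.
Hypothesis UL : (#|U| <= 2 ^ L)%N.

Lemma leaf_inj l B i u v : (L <= l)%N -> B \in level_boxes l ->
  u \in B i -> v \in B i -> u = v.
Proof.
move=> Ll Bl uB vB; apply: enum_rank_inj; apply: val_inj.
apply: (@eq_from_bits L); try exact: leq_trans (ltn_ord _) UL.
move=> k kL; have := level_boxes_bits Bl uB vB (leq_trans kL Ll).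
by rewrite !inE.
Qed.

(** From depth L on, a box holds at most one tuple. If that tuple lies in [h], its entries are
    distinct, so the coordinates are disjoint singletons and the query sees it: one query is an
    exact count. *)
Lemma leaf_count h l B (q : box -> bool) :
  (forall t, h t -> injective t) ->
  (forall A, q A = disjoint_box A && [exists t, h t && in_box t A]) ->
  (L <= l)%N -> B \in level_boxes l -> box_count h B = q B.
Proof.
move=> hI qE Ll Bl; rewrite qE.
have uniq_t t t' : in_box t B -> in_box t' B -> t = t'.
  move=> /in_boxP tB /in_boxP tB'; apply/ffunP => i.
  exact: leaf_inj Ll Bl (tB i) (tB' i).
case: (boolP [exists t, h t && in_box t B]) => [/existsP[t /andP[ht tB]]|/existsPn no].
  have -> : disjoint_box B.
    apply/forallP => i; apply/forallP => j; apply/implyP => ij.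
    apply/pred0P => u /=; apply/negP => /andP[ui uj]; case/eqP: ij.
    move/in_boxP: tB => tB; apply: (hI t ht).
    by rewrite (leaf_inj Ll Bl (tB i) ui) (leaf_inj Ll Bl (tB j) uj).
  rewrite andTb -[RHS]/1%N -(card1 t); apply: eq_card => t'; rewrite !inE.
  apply/andP/eqP => [[_ tB']|->] //; exact: uniq_t.
by rewrite andbF; apply/eqP/pred0P => t /=; apply/negbTE/no.
Qed.

End Leaves.

End BoxTree.

(** * Coarse counting by thinned and coloured queries *)

Section CoarseCounting.
Variables (R : realFieldType) (U : finType) (d0 L K : nat).
Local Notation d := d0.+1.
Local Notation box := {ffun 'I_d -> {set U}}.
Variable chi : {ffun 'I_(hash_size d L) -> colouring U d}.

Definition coloured (c : colouring U d) (B : box) : box :=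
  [ffun i => [set u in B i | c u == i]].

Definition probe_box (c : colouring U d) (B : box) (s : {ffun 'I_d -> thinning U L})
    (j : {ffun 'I_d -> 'I_L.+1}) : box :=
  [ffun i => coloured c B i :&: thinned_box s j i].

Definition probe_index : finType :=
  ('I_(hash_size d L) * 'I_K * {ffun 'I_d -> 'I_L.+1})%type.

(** The same K thinnings serve all boxes, colourings and exponents: independence is used only among
    the K votes, and the rest is a union bound. *)
Definition coarse_seed := {ffun 'I_K -> {ffun 'I_d -> thinning U L}}.

Definition probe (s : coarse_seed) (B : box) (p : probe_index) : box :=
  probe_box (chi p.1.1) B (s p.1.2) p.2.

Definition vote (ans : {ffun probe_index -> bool}) k r (x : 'I_K) : bool :=
  [exists j : {ffun 'I_d -> 'I_L.+1}, (\sum_i j i == r)%N && ans (k, x, j)].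

Definition majority (ans : {ffun probe_index -> bool}) k r : bool :=
  (K <= 2 * #|[set x | vote ans k r x]|)%N.

(** Summing the accepted powers requires no monotonicity of the votes: powers of 2 below a threshold
    add up to at most twice that threshold. *)
Definition coarse_of_answers (ans : {ffun probe_index -> bool}) : nat :=
  \sum_k \sum_(r < (L * d).+1) majority ans k r * 2 ^ r.

Definition coarse_count (q : box -> bool) (s : coarse_seed) (B : box) : nat :=
  coarse_of_answers [ffun p => q (probe s B p)].

(** The bound 4 B (L d + 1) of [hit_ge] at B = 16 d, where the failure probability d / 2 ^ B is at
    most 1/16. *)
Definition thin_const := (64 * d * (L * d + 1))%N.

Variables (h : pred {ffun 'I_d -> U}) (q : box -> bool).
Hypothesis UL : (#|U| <= 2 ^ L)%N.
Hypothesis qE : forall A, q A = disjoint_box A && [exists t, h t && in_box t A].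

Let coloured_pred c B : pred {ffun 'I_d -> U} :=
  fun t => h t && in_box t (coloured c B).

Lemma probe_disjoint c B s j : disjoint_box (probe_box c B s j).
Proof.
apply/forallP => i; apply/forallP => i'; apply/implyP => ii'.
apply/pred0P => u /=; rewrite !ffunE !inE; apply/negP.
move=> /andP[/andP[/andP[_ /eqP ui] _] /andP[/andP[_ /eqP ui'] _]].
by rewrite -ui -ui' eqxx in ii'.
Qed.

(** Colour classes make every probe disjoint, so the oracle tells exactly whether a properly
    coloured tuple of [B] survives. *)
Lemma vote_hit s B k r x :
  vote [ffun p => q (probe s B p)] k r x = hit (coloured_pred (chi k) B) r (s x).
Proof.
apply: eq_existsb => j; congr (_ && _); rewrite ffunE qE probe_disjoint /=.
apply: eq_existsb => t; rewrite -andbA; congr (_ && _).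
apply/in_boxP/andP => [H|[/in_boxP H1 /in_boxP H2] i]; last first.
  by rewrite ffunE inE H1 H2.
by split; apply/in_boxP => i; have := H i; rewrite ffunE inE => /andP[].
Qed.

Lemma coloured_count_le B k : (#|coloured_pred (chi k) B| <= box_count h B)%N.
Proof.
apply: subset_leq_card; apply/subsetP => t; rewrite !inE => /andP[-> /in_boxP tB].
by apply/in_boxP => i; have := tB i; rewrite ffunE inE => /andP[].
Qed.

Hypothesis chiP : forall tau : {ffun 'I_d -> U}, injective tau ->
      exists k, forall i, chi k (tau i) = i.
Hypothesis hI : forall t, h t -> injective t.

Lemma coloured_count_ge B :
  (box_count h B <= \sum_k #|coloured_pred (chi k) B|)%N.
Proof.
pose T : finType := ('I_(hash_size d L) * {ffun 'I_d -> U})%type.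
have -> : (\sum_k #|coloured_pred (chi k) B|)%N =
    #|[pred p : T | coloured_pred (chi p.1) B p.2]|.
  rewrite -sum1_card -(pair_big_dep xpredT (fun k t => coloured_pred (chi k) B t)
    (fun _ _ => 1%N)) /=.
  by apply: eq_bigr => k _; rewrite sum1_card.
pose f (p : T) := p.2.
apply: leq_trans (leq_imset_card f _); apply: subset_leq_card.
apply/subsetP => t; rewrite inE => /andP[ht /in_boxP tB].
have [k Hk] := chiP (hI ht); apply/imsetP; exists (k, t) => //.
rewrite inE /= /coloured_pred ht; apply/in_boxP => i.
by rewrite ffunE inE tB Hk eqxx.
Qed.

(** A single vote accepts a [low] guess and rejects a [high] one, each up to probability 1/16;
    nothing is promised for guesses in between. *)
Let low k B (r : nat) := (0 < #|coloured_pred (chi k) B|)%N &&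
  ((r == 0%N) || (2 ^ r * thin_const ^ d <= #|coloured_pred (chi k) B|)%N).
Let high k B (r : nat) := (16 * (L.+1 ^ d0 * #|coloured_pred (chi k) B|) <= 2 ^ r)%N.

Definition coarse_consistent (s : coarse_seed) B : bool :=
  [forall k, forall r : 'I_(L * d).+1,
    let maj := majority [ffun p => q (probe s B p)] k r in
    (low k B r ==> maj) && (high k B r ==> ~~ maj)].

Lemma card_coarse_seed1 : (0 < #|{: {ffun 'I_d -> thinning U L}}|)%N.
Proof. by rewrite card_ffun expn_gt0 card_thinning_gt0. Qed.

Lemma coarse_inconsistent_le (N : {set box}) :
  Ex (fun s => [exists B, (B \in N) && ~~ coarse_consistent s B]%:R) <=
  (#|N| * (hash_size d L * (L * d).+1 * 2))%:R / 2 ^+ K :> R.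
Proof.
pose I : finType := (box * ('I_(hash_size d L) * 'I_(L * d).+1 * bool))%type.
pose maj (s : coarse_seed) B k r := majority [ffun p => q (probe s B p)] k r.
pose P := [pred p : I | (p.1 \in N) &&
  (if p.2.2 then low p.2.1.1 p.1 p.2.1.2 else high p.2.1.1 p.1 p.2.1.2)].
pose Bad (p : I) (s : coarse_seed) := p.2.2 (+) maj s p.1 p.2.1.1 p.2.1.2.
have bnd (p : I) : P p -> Ex (fun s => (Bad p s)%:R) <= (2 ^+ K)^-1 :> R.
  case: p => [B [[k r] [|]]] /= /andP[_].
    move=> /andP[h0 hr].
    have miss16 : Ex (fun s => (~~ hit (L := L) (coloured_pred (chi k) B) r s)%:R) <= 16^-1 :> R.
      apply: le_trans (hit_ge (B := 16 * d) (W := thin_const) R UL _ _ h0 hr) _ => //.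
        by rewrite /thin_const; lia.
      rewrite ler_pdivrMr ?exprn_gt0 // mulrC ler_pdivlMr // -natrM -natrX ler_nat mulnC.
      exact/ltnW/ltn_expl.
    apply: le_trans (majority_bound K card_coarse_seed1 miss16).
    apply: le_Ex => s; rewrite ler_nat /Bad /= /maj /majority.
    rewrite (_ : [set x | vote _ _ _ _] =
      ~: [set i | ~~ hit (coloured_pred (chi k) B) r (s i)]); last first.
      by apply/setP => x; rewrite !inE vote_hit negbK.
    set A := [set i | _]; have := cardsC A; rewrite card_ord => cA.
    case: (leqP K (2 * #|~: A|)) => // lt.
    by have -> : (K <= 2 * #|A|)%N by lia.
  move=> hr.
  have hit16 : Ex (fun s => (hit (L := L) (coloured_pred (chi k) B) r s)%:R) <= 16^-1 :> R.
    apply: le_trans (hit_le R _ _ _) _.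
    rewrite ler_pdivrMr ?exprn_gt0 // mulrC ler_pdivlMr // -natrM -natrX ler_nat mulnC.
    exact: hr.
  apply: le_trans (majority_bound K card_coarse_seed1 hit16).
  apply: le_Ex => s; rewrite ler_nat /Bad /= /maj /majority.
  rewrite (_ : [set x | vote _ _ _ _] = [set i | hit (coloured_pred (chi k) B) r (s i)]) //.
  by apply/setP => x; rewrite !inE vote_hit.
apply: le_trans (le_trans (union_bound bnd) _).
  apply: le_Ex => s; rewrite ler_nat.
  have [/existsP[B /andP[BN /forallPn[k /forallPn[r]]]]|//] :=
    boolP [exists B, (B \in N) && ~~ coarse_consistent s B].
  rewrite /= negb_and (negb_imply (low _ _ _)) (negb_imply (high _ _ _)) negbK => bad; rewrite lt0b; apply/existsP.
  case/orP: bad => /andP[cond Hmaj].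
    by exists (B, (k, r, true)); rewrite /P /Bad /maj /= BN cond Hmaj.
  by exists (B, (k, r, false)); rewrite /P /Bad /maj /= BN cond Hmaj.
rewrite ler_wpM2r ?invr_ge0 ?exprn_ge0 // ler_nat.
apply: (@leq_trans #|setX N [set: 'I_(hash_size d L) * 'I_(L * d).+1 * bool]|).
  apply: subset_leq_card; apply/subsetP => p; rewrite inE => /andP[pN _].
  by rewrite inE pN inE.
by rewrite cardsX cardsT !card_prod !card_ord card_bool.
Qed.

Lemma sum_powers_lt n : (\sum_(r < n) 2 ^ r < 2 ^ n)%N.
Proof.
elim: n => [|n IH]; first by rewrite big_ord0.
by rewrite big_ord_recr /= expnS mul2n -addnn -addSn leq_add2r.
Qed.

Lemma sum_powers_below n X : (\sum_(r < n) (2 ^ r < X) * 2 ^ r <= 2 * X)%N.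
Proof.
elim: n => [|n IH]; first by rewrite big_ord0.
rewrite big_ord_recr /=; case: ltnP => [lt|_]; last by rewrite mul0n addn0.
rewrite mul1n mul2n -addnn; apply: leq_add (ltnW lt).
apply: leq_trans (ltnW lt); apply: leq_trans (ltnW (sum_powers_lt n)).
by apply: leq_sum => r _; case: (_ < _)%N; rewrite ?mul1n ?mul0n.
Qed.

Section Consistent.
Variables (s : coarse_seed) (B : box).
Hypothesis cons : coarse_consistent s B.

Lemma coarse_count_ge : (box_count h B <= 2 * thin_const ^ d * coarse_count q s B)%N.
Proof.
apply: leq_trans (coloured_count_ge B) _; rewrite /coarse_count /coarse_of_answers.
rewrite big_distrr /=; apply: leq_sum => k _.
set m := #|_|; have [->//|m0] := posnP m.
have W0 : (0 < thin_const ^ d)%N by rewrite expn_gt0 /thin_const !muln_gt0 addn1.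
have mL : (m <= 2 ^ (L * d))%N.
  apply: leq_trans (max_card _) _.
  by rewrite card_ffun card_ord expnM leq_exp2r.
(* The largest power with 2 ^ r W ^ d <= m, for W = [thin_const]. If m < W ^ d the quotient is 0 and
   so is r, which is low by the first alternative; in both cases m < 2 ^ r.+1 W ^ d. *)
pose r := trunc_log 2 (m %/ thin_const ^ d).
have rL : (r < (L * d).+1)%N.
  rewrite ltnS; have [z|z] := posnP (m %/ thin_const ^ d).
    by rewrite /r z trunc_log0.
  rewrite -(leq_exp2l (m := 2)) //; apply: leq_trans (trunc_logP _ z) _ => //.
  by apply: leq_trans mL; exact: leq_div.
have lowr : low k B (Ordinal rL).
  rewrite /low m0 /= -/m /r; have [z|z] := posnP (m %/ thin_const ^ d).
    by rewrite z trunc_log0.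
  by rewrite -leq_divRL // trunc_logP // orbT.
have maj : majority [ffun p => q (probe s B p)] k r.
  have /forallP/(_ k)/forallP/(_ (Ordinal rL)) := cons.
  by rewrite lowr /= => /andP[].
rewrite (bigD1 (Ordinal rL)) //= maj mul1n mulnDr.
apply: leq_trans (leq_addr _ _).
have : (m %/ thin_const ^ d < 2 ^ r.+1)%N by exact: trunc_log_ltn.
by rewrite ltn_divLR // expnS => /ltnW; rewrite mulnAC.
Qed.

(** An accepted guess is not high, so its power stays below 16 (L + 1) ^ d0 times the count. The
    geometric sum doubles this to 32, and each colouring may count the whole box. *)
Lemma coarse_count_le :
  (coarse_count q s B <= 32 * L.+1 ^ d0 * hash_size d L * box_count h B)%N.
Proof.
have -> : (32 * L.+1 ^ d0 * hash_size d L * box_count h B =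
    \sum_(k < hash_size d L) 2 * (16 * (L.+1 ^ d0 * box_count h B)))%N.
  by rewrite sum_nat_const card_ord; ring.
apply: leq_sum => k _.
apply: leq_trans (sum_powers_below (L * d).+1 _); apply: leq_sum => r _.
rewrite leq_mul2r; apply/orP; right.
case maj: (majority _ k r) => //; rewrite lt0b ltnNge; apply/negP => le.
have /forallP/(_ k)/forallP/(_ r) := cons; rewrite maj /= => /andP[_].
suff -> : high k B r by [].
apply: leq_trans le; rewrite !leq_mul2l /= coloured_count_le orbT.
by rewrite ?orbT.
Qed.

End Consistent.

End CoarseCounting.

(** * Weighted populations *)

Section IidSums.
Variables (R : realFieldType) (Y : finType) (g : Y -> R).
Hypothesis Y0 : (0 < #|Y|)%N.

Let ffun_gt0 n : (0 < #|{: {ffun 'I_n -> Y}}|)%N.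
Proof. by rewrite card_ffun expn_gt0 Y0. Qed.

Lemma Ex_iid_sum n :
  Ex (fun f : {ffun 'I_n -> Y} => \sum_k g (f k)) = n%:R * Ex g.
Proof.
rewrite Ex_sum (eq_bigr (fun=> Ex g)) => [|k _]; last exact: Ex_ffun_at.
by rewrite sumr_const card_ord mulr_natl.
Qed.

Lemma Ex_iid_sum_sqr n :
  Ex (fun f : {ffun 'I_n -> Y} => (\sum_k g (f k)) ^+ 2) <=
  n%:R * Ex (fun y => g y ^+ 2) + (n%:R * Ex g) ^+ 2.
Proof.
elim: n => [|n IH].
  rewrite (eq_Ex (g := fun=> 0)) => [|f]; last by rewrite big_ord0 expr0n.
  by rewrite Ex_cst // !mul0r expr0n addr0.
rewrite Ex_fcons.
have -> : Ex (fun y => Ex (fun f : {ffun 'I_n -> Y} => (\sum_k g (fcons y f k)) ^+ 2)) =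
    Ex (fun y => g y ^+ 2) + 2 * Ex g * (n%:R * Ex g) +
    Ex (fun f : {ffun 'I_n -> Y} => (\sum_k g (f k)) ^+ 2).
  set S2 := Ex (fun f : {ffun 'I_n -> Y} => _).
  have inner y : Ex (fun f : {ffun 'I_n -> Y} => (\sum_k g (fcons y f k)) ^+ 2) =
      g y ^+ 2 + (2 * (n%:R * Ex g) * g y + S2).
    transitivity (Ex (fun f : {ffun 'I_n -> Y} =>
        g y ^+ 2 + (2 * g y * (\sum_k g (f k)) + (\sum_k g (f k)) ^+ 2))).
      apply: eq_Ex => f; rewrite big_ord_recl fcons0.
      by under eq_bigr do rewrite fconsS; ring.
    by rewrite !ExD Ex_cst // ExZ Ex_iid_sum -/S2; ring.
  by rewrite (eq_Ex inner) !ExD ExZ Ex_cst //; ring.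
apply: le_trans (lerD (lexx _) IH) _.
have : 0 <= Ex g ^+ 2 by rewrite sqr_ge0.
rewrite -[n.+1%:R]natr1; set e := Ex g; set e2 := Ex _ => e0.
rewrite -subr_ge0; set x := n%:R; rewrite (_ : _ - _ = e ^+ 2) //; ring.
Qed.

End IidSums.

Section Population.
Variables (R : realType) (V : Type) (Sg : finType) (sg0 : Sg) (N0 : nat).
Variables (child : nat -> V -> Sg -> V).

Local Notation N := N0.+1.

Definition offspring : finType := ('I_N * Sg)%type.
(** The least size that [exists_resampling] admits. *)
Definition resample_size := (2 * #|offspring|)%N.
Definition population := {ffun 'I_N -> R * V}.

Definition selection (a : {ffun offspring -> R}) : {ffun 'I_resample_size -> offspring} :=
  projT1 (cid (exists_resampling (ord0, sg0) (leqnn resample_size) a)).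

Definition multiplicity a i : nat := #|[set x | selection a x == i]|.

(* The weight correction uses the actual multiplicity, so that resampling is unbiased. *)
Definition resample l (P : population) (ca : {ffun offspring -> R})
    (x : {ffun 'I_N -> 'I_resample_size}) : population :=
  let a := [ffun i : offspring => (P i.1).1 * ca i] in
  [ffun k => let i := selection a (x k) in
     ((P i.1).1 * resample_size%:R / (N%:R * (multiplicity a i)%:R),
      child l (P i.1).2 i.2)].

(** All children are estimated before any is drawn, since the drawing proportions are relative to
    the whole generation. *)
Definition offspring_coarse (c : V -> R) l (P : population) : {ffun offspring -> R} :=
  [ffun i => c (child l (P i.1).2 i.2)].

Definition generation_seed := {ffun 'I_N -> 'I_resample_size}.

Fixpoint evolve (c : V -> R) D l (P : population) :
    {ffun 'I_D -> generation_seed} -> population :=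
  match D with
  | 0 => fun _ => P
  | D'.+1 => fun x =>
      evolve c l.+1 (resample l P (offspring_coarse c l P) (x ord0)) (ftail x)
  end.

Definition total (m : V -> nat) (P : population) : R :=
  \sum_k (P k).1 * (m (P k).2)%:R.

Lemma selectionP (a : {ffun offspring -> R}) i : (forall i, 0 <= a i) ->
  a i * resample_size%:R <= 2 * (\sum_j a j) * (multiplicity a i)%:R.
Proof. by rewrite /multiplicity /selection; case: cid => f /= H /H; apply. Qed.

Lemma offspring_gt0 : (0 < #|offspring|)%N.
Proof. by apply/card_gt0P; exists (ord0, sg0). Qed.

Lemma resample_size_gt0 : (0 < resample_size)%N.
Proof. by rewrite muln_gt0 offspring_gt0. Qed.

Lemma generation_seed_gt0 : (0 < #|{: generation_seed}|)%N.
Proof. by rewrite card_ffun expn_gt0 card_ord resample_size_gt0. Qed.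

Lemma Ex_selection a (F : offspring -> R) :
  Ex (fun x => F (selection a x)) =
  (\sum_i (multiplicity a i)%:R * F i) / resample_size%:R.
Proof.
rewrite /Ex card_ord; congr (_ / _).
rewrite (partition_big (selection a) predT) //=; apply: eq_bigr => i _.
rewrite (eq_bigr (fun=> F i)) => [|x /eqP -> //].
rewrite sumr_const mulr_natl; congr (_ *+ _).
by apply: eq_card => x; rewrite !inE.
Qed.

Variables (good : nat -> V -> Prop) (m : V -> nat) (c : V -> R) (alpha beta : R).
Hypothesis good_child : forall l B s, good l B -> good l.+1 (child l B s).
Hypothesis m_split : forall l B, good l B -> m B = (\sum_s m (child l B s))%N.
Hypothesis alpha0 : 0 <= alpha.
Hypothesis beta0 : 0 <= beta.
Hypothesis c_ge0 : forall B, 0 <= c B.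

Definition healthy l (P : population) :=
  forall k, 0 <= (P k).1 /\ good l (P k).2.

Definition coarse_at l := forall B, good l B ->
  (m B)%:R <= alpha * c B /\ c B <= beta * (m B)%:R.

Lemma resample_healthy l P x :
  healthy l P -> healthy l.+1 (resample l P (offspring_coarse c l P) x).
Proof.
move=> HP k; rewrite /resample ffunE /=; set i := selection _ _.
have [w0 g] := HP i.1; split; last exact: good_child.
by rewrite !(mulr_ge0, invr_ge0, ler0n).
Qed.

Section OneGeneration.
Variables (l : nat) (P : population).
Hypotheses (HP : healthy l P) (Hc : coarse_at l.+1).

Let a := [ffun i : offspring => (P i.1).1 * offspring_coarse c l P i].
Let mass (i : offspring) : R := (P i.1).1 * (m (child l (P i.1).2 i.2))%:R.
Let y (x : 'I_resample_size) : R :=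
  let i := selection a x in
  mass i * resample_size%:R / (N%:R * (multiplicity a i)%:R).

Let a_ge0 i : 0 <= a i.
Proof. by rewrite !ffunE mulr_ge0 //; case: (HP i.1). Qed.

Let mass_ge0 i : 0 <= mass i.
Proof. by rewrite mulr_ge0 ?ler0n //; case: (HP i.1). Qed.

Let mass_le i : mass i <= alpha * a i.
Proof.
have [w0 g] := HP i.1; have [le _] := Hc (good_child i.2 g).
by rewrite !ffunE mulrCA ler_wpM2l.
Qed.

Let a_le i : a i <= beta * mass i.
Proof.
have [w0 g] := HP i.1; have [_ le] := Hc (good_child i.2 g).
by rewrite !ffunE mulrCA ler_wpM2l.
Qed.

Let total_mass : \sum_i mass i = total m P.
Proof.
rewrite /total /mass -(pair_bigA _ (fun k s => (P k).1 * (m (child l (P k).2 s))%:R)) /=.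
apply: eq_bigr => k _; have [_ g] := HP k.
by rewrite (m_split g) natr_sum mulr_sumr.
Qed.

(** Two consequences: a child with positive mass has positive multiplicity, so the mean is exact,
    and a draw contributes at most 2 alpha (\sum_j a j) / N, which bounds the second moment. *)
Let mass_mult i :
  mass i * resample_size%:R <= 2 * alpha * (\sum_j a j) * (multiplicity a i)%:R.
Proof.
apply: (@le_trans _ _ (alpha * a i * resample_size%:R)); first by rewrite ler_wpM2r.
rewrite -[_ * a i * _]mulrA [2 * _]mulrC -!mulrA ler_wpM2l //.
rewrite mulrA; exact: selectionP.
Qed.

Let total_resample x : total m (resample l P (offspring_coarse c l P) x) = \sum_k y (x k).
Proof.
rewrite /total; apply: eq_bigr => k _; rewrite ffunE /= /y /mass -/a.
set i := selection _ _; ring.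
Qed.

Let R0 : (resample_size%:R : R) != 0.
Proof. by rewrite pnatr_eq0 -lt0n resample_size_gt0. Qed.

Let N0' : (N%:R : R) != 0.
Proof. by rewrite pnatr_eq0. Qed.

Let mass_mult0 i : multiplicity a i = 0%N -> mass i = 0.
Proof.
move=> z; have := mass_mult i; rewrite z mulr0 => le.
apply/eqP; rewrite eq_le mass_ge0 andbT.
by move: le; rewrite pmulr_lle0 // ltr0n resample_size_gt0.
Qed.

Let Ex_y : Ex y = total m P / N%:R.
Proof.
rewrite (Ex_selection a (fun i => mass i * resample_size%:R / (N%:R * (multiplicity a i)%:R))).
rewrite -total_mass !mulr_suml; apply: eq_bigr => i _.
have [z|nz] := eqVneq (multiplicity a i) 0%N; first by rewrite mass_mult0 // !mul0r !mulr0 mul0r.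
have nz' : (multiplicity a i)%:R != 0 :> R by rewrite pnatr_eq0.
by field; rewrite nat1r; apply/and3P.
Qed.

Let Ex_y2 : Ex (fun x => y x ^+ 2) <= 2 * alpha * beta * total m P ^+ 2 / N%:R ^+ 2.
Proof.
rewrite (Ex_selection a
  (fun i => (mass i * resample_size%:R / (N%:R * (multiplicity a i)%:R)) ^+ 2)).
(* One factor of the square is bounded by [mass_mult]. The other leaves a mass, and masses sum to
   the total; [a_le] then compares the sum of [a] with the total. *)
apply: (@le_trans _ _ (\sum_i 2 * alpha * (\sum_j a j) * mass i / N%:R ^+ 2)).
  rewrite mulr_suml; apply: ler_sum => i _.
  have [z|nz] := eqVneq (multiplicity a i) 0%N.
    by rewrite (mass_mult0 z) z !(mul0r, mulr0).
  have nz' : (multiplicity a i)%:R != 0 :> R by rewrite pnatr_eq0.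
  set mu := (multiplicity a i)%:R in nz' *.
  have -> : mu * (mass i * resample_size%:R / (N%:R * mu)) ^+ 2 / resample_size%:R =
      mass i * (mass i * resample_size%:R / mu) / N%:R ^+ 2.
    by field; rewrite nat1r; apply/and3P.
  rewrite ler_wpM2r ?invr_ge0 ?exprn_ge0 ?ler0n // [leRHS]mulrC ler_wpM2l //.
  by rewrite ler_pdivrMr ?mass_mult // lt_def nz' ler0n.
rewrite -mulr_suml -mulr_sumr total_mass ler_wpM2r ?invr_ge0 ?exprn_ge0 ?ler0n //.
rewrite expr2 !mulrA ler_wpM2r -?total_mass ?sumr_ge0 //.
rewrite -!mulrA ler_wpM2l // ler_wpM2l //.
by rewrite mulr_sumr; apply: ler_sum => i _; exact: a_le.
Qed.

Lemma Ex_total_resample :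
  Ex (fun x => total m (resample l P (offspring_coarse c l P) x)) = total m P.
Proof.
rewrite (eq_Ex total_resample) (Ex_iid_sum _ _) ?card_ord ?resample_size_gt0 //.
by rewrite Ex_y mulrC divfK.
Qed.

(** The N draws are independent, so only the diagonal terms are in excess of the squared mean, and
    they carry a factor 1 / N. *)
Lemma Ex_total_resample_sqr :
  Ex (fun x => total m (resample l P (offspring_coarse c l P) x) ^+ 2) <=
  (1 + 2 * alpha * beta / N%:R) * total m P ^+ 2.
Proof.
rewrite (eq_Ex (g := fun x : generation_seed => (\sum_k y (x k)) ^+ 2)) => [|x]; last first.
  by rewrite total_resample.
apply: le_trans (Ex_iid_sum_sqr _ _ _) _; first by rewrite card_ord resample_size_gt0.
rewrite Ex_y [N%:R * (total m P / _)]mulrC divfK // mulrDl mul1r addrC lerD2l.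
apply: le_trans (ler_wpM2l _ Ex_y2) _ => //.
by rewrite le_eqVlt; apply/orP; left; apply/eqP; field; rewrite nat1r.
Qed.

End OneGeneration.

Lemma evolve_healthy D l P x : healthy l P -> healthy (l + D) (evolve c (D := D) l P x).
Proof.
elim: D l P x => [|D IH] l P x HP; first by rewrite addn0.
by rewrite addnS -addSn; apply: IH; exact: resample_healthy.
Qed.

Let seeds_gt0 D : (0 < #|{: {ffun 'I_D -> generation_seed}}|)%N.
Proof. by rewrite card_ffun expn_gt0 generation_seed_gt0. Qed.

Lemma Ex_total_evolve D l P : healthy l P ->
  (forall l', (l <= l' <= l + D)%N -> coarse_at l') ->
  Ex (fun x => total m (evolve c (D := D) l P x)) = total m P.
Proof.
elim: D l P => [|D IH] l P HP Hc; first by rewrite /= Ex_cst.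
rewrite Ex_fcons -[RHS](Ex_total_resample HP); last by apply: Hc; lia.
apply: eq_Ex => y; rewrite -[RHS](IH l.+1); last 2 first.
- exact: resample_healthy.
- by move=> l' Hl'; apply: Hc; lia.
by apply: eq_Ex => x /=; rewrite fcons0 fconsK.
Qed.

Lemma Ex_total_evolve_sqr D l P : healthy l P ->
  (forall l', (l <= l' <= l + D)%N -> coarse_at l') ->
  Ex (fun x => total m (evolve c (D := D) l P x) ^+ 2) <=
  (1 + 2 * alpha * beta / N%:R) ^+ D * total m P ^+ 2.
Proof.
elim: D l P => [|D IH] l P HP Hc; first by rewrite /= Ex_cst // mul1r.
set eta := 1 + _.
have eta0 : 0 <= eta by rewrite /eta !(addr_ge0, mulr_ge0, invr_ge0).
rewrite Ex_fcons; apply: (@le_trans _ _ (Ex (fun y => eta ^+ D *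
    total m (resample l P (offspring_coarse c l P) y) ^+ 2))).
  apply: le_Ex => y; apply: le_trans (IH l.+1 _ _ _); last 2 first.
  - exact: resample_healthy.
  - by move=> l' Hl'; apply: Hc; lia.
  by apply: le_Ex => x /=; rewrite fcons0 fconsK.
rewrite ExZ exprSr -mulrA ler_wpM2l ?exprn_ge0 //.
by apply: Ex_total_resample_sqr => //; apply: Hc; lia.
Qed.

End Population.

(** * Fine counting *)

Section FineCounting.
Variables (R : realType) (U : finType) (d0 L K N0 : nat) (delta : R).
Local Notation d := d0.+1.
Local Notation N := N0.+1.
Local Notation box := {ffun 'I_d -> {set U}}.
Local Notation signs := {ffun 'I_d -> bool}.
Variable chi : {ffun 'I_(hash_size d L) -> colouring U d}.

Definition trial_seed := {ffun 'I_L -> generation_seed signs N0}.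

Definition fine_seed := {ffun 'I_K -> trial_seed}.

Definition initial_population (B : box) : population R box N0 :=
  [ffun=> (N%:R^-1, B)].

(* All L generations are run from every level l <= L, possibly below the leaves,
   so that the seed type does not depend on l. *)
Definition final_population (q : box -> bool) (s : coarse_seed U d0 L K) l B
    (x : trial_seed) : population R box N0 :=
  evolve [ffun=> false] (@subbox U d) (fun B => (coarse_count chi q s B)%:R) l
    (initial_population B) x.

Definition weigh (P : population R box N0) (ans : {ffun 'I_N -> bool}) : R :=
  \sum_k (P k).1 * (ans k)%:R.

Definition trial q s l B x : R :=
  weigh (final_population q s l B x) [ffun k => q (final_population q s l B x k).2].

Definition close_trials (v : {ffun 'I_K -> R}) (y : R) : {set 'I_K} :=
  [set k | `|v k - y| <= delta * y].

(* Any such number shares a close trial with the true count, so no median is needed. *)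
Definition consensus (v : {ffun 'I_K -> R}) : nat :=
  if [pick y : 'I_(2 ^ (L * d)).+1 | (K < 2 * #|close_trials v (y : nat)%:R|)%N]
    is Some y then y else 0%N.

Definition fine_count q s (w : fine_seed) l B : nat :=
  consensus [ffun k => trial q s l B (w k)].

Lemma consensus_le v : (consensus v <= 2 ^ (L * d))%N.
Proof. by rewrite /consensus; case: pickP => // y _; rewrite -ltnS. Qed.

(** The close trials of y and of m are both strict majorities, so they share some z, and |y - m| <=
    delta (y + m). For delta <= 1/4 this gives y <= 5/3 m, hence an error below 3 delta m. *)
Lemma consensus_close v (m : nat) : 0 <= delta -> delta <= 4^-1 ->
  (m <= 2 ^ (L * d))%N -> (K < 2 * #|close_trials v m%:R|)%N ->
  `|(consensus v)%:R - m%:R| <= 3 * delta * m%:R.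
Proof.
move=> delta0 delta4 mL maj; rewrite /consensus; case: pickP => [y majy|no]; last first.
  have mL' : (m < (2 ^ (L * d)).+1)%N by [].
  by have := no (Ordinal mL'); rewrite maj.
have [k] : exists k, k \in close_trials v (y : nat)%:R :&: close_trials v m%:R.
  apply/set0Pn; rewrite -card_gt0; move: maj majy.
  set A := close_trials v m%:R; set B := close_trials v _ => majA majB.
  have : (#|B :|: A| <= K)%N by rewrite -[leqRHS]card_ord; exact: max_card.
  have := cardsUI B A; lia.
rewrite !inE => /andP[]; have : 0 <= m%:R :> R by []; have : 0 <= y%:R :> R by [].
move: (v k) (y%:R : R) (m%:R : R) => z a b a0 b0.
rewrite !ler_norml => /andP[? ?] /andP[? ?]; apply/andP; split; nra.
Qed.

(** [fine_alpha] and [fine_beta] are the distortions in [coarse_count_ge] and [coarse_count_le];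
    their product, of order L ^ (2 d), is the polylogarithmic loss b. *)
Definition fine_alpha : R := 2 * (thin_const d0 L)%:R ^+ d.
Definition fine_beta : R := (32 * L.+1 ^ d0 * hash_size d L)%:R.

Variables (h : pred {ffun 'I_d -> U}) (q : box -> bool).
Hypothesis UL : (#|U| <= 2 ^ L)%N.
Hypothesis qE : forall A, q A = disjoint_box A && [exists t, h t && in_box t A].
Hypothesis chiP : forall tau : {ffun 'I_d -> U}, injective tau ->
      exists k, forall i, chi k (tau i) = i.
Hypothesis hI : forall t, h t -> injective t.
Hypothesis delta0 : 0 < delta.
Hypothesis delta4 : delta <= 4^-1.
Hypothesis N_large : 64 * L%:R * (fine_alpha * fine_beta) <= delta ^+ 2 * N%:R.

Lemma box_count_le B : (box_count h B <= 2 ^ (L * d))%N.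
Proof.
apply: leq_trans (max_card _) _.
by rewrite card_ffun card_ord expnM leq_exp2r.
Qed.

Section ConsistentCoarse.
Variable s : coarse_seed U d0 L K.
(** L generations started at a level l <= L end at level 2 L at the latest. *)
Hypothesis cons :
  forall B, B \in boxes_below U d (2 * L).+1 -> coarse_consistent chi h q s B.

Let c (B : box) : R := (coarse_count chi q s B)%:R.
Let m := box_count h.
Let good l (B : box) : Prop := B \in level_boxes U d l.

Let alpha0 : 0 <= fine_alpha.
Proof. by rewrite mulr_ge0 ?exprn_ge0. Qed.

Let beta0 : 0 <= fine_beta. Proof. exact: ler0n. Qed.

Let coarse_ok l : (l <= 2 * L)%N -> coarse_at good m c fine_alpha fine_beta l.
Proof.
move=> lL B Bl; have cB := cons (boxes_belowP (n := (2 * L).+1) lL Bl).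
split; last by rewrite -natrM ler_nat; exact: coarse_count_le.
by rewrite /fine_alpha -natrX -!natrM ler_nat; exact: coarse_count_ge.
Qed.

Section OneBox.
Variables (l : nat) (B : box).
Hypotheses (lL : (l <= L)%N) (Bl : B \in level_boxes U d l).

Let start_healthy : healthy good l (initial_population B).
Proof. by move=> k; rewrite ffunE /=; split; first by rewrite invr_ge0. Qed.

Let start_total : total m (initial_population B) = (m B)%:R.
Proof.
rewrite /total (eq_bigr (fun=> N%:R^-1 * (m B)%:R)) => [|k _]; last by rewrite ffunE.
by rewrite sumr_const card_ord -mulrnAl -[_ *+ _]mulr_natr mulVf ?mul1r // pnatr_eq0.
Qed.

Let good_child l' B' s' : good l' B' -> good l'.+1 (subbox l' B' s').
Proof. exact: level_boxesS. Qed.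

Let m_split l' B' : good l' B' -> m B' = (\sum_(sg : signs) m (subbox l' B' sg))%N.
Proof. by move=> _; exact: box_count_split. Qed.

Let c_ge0 B' : 0 <= c B'. Proof. exact: ler0n. Qed.

Let trialE x : trial q s l B x = total m (final_population q s l B x).
Proof.
apply: eq_bigr => k _; rewrite ffunE; congr (_ * _%:R).
have := evolve_healthy [ffun=> false] c good_child (D := L) x start_healthy.
move=> /(_ k)[_ gk].
exact: esym (leaf_count UL hI qE (leq_addl _ _) gk).
Qed.

Let coarse_range l' : (l <= l' <= l + L)%N -> coarse_at good m c fine_alpha fine_beta l'.
Proof. by move=> H; apply: coarse_ok; lia. Qed.

Let Ex_trial : Ex (fun x => trial q s l B x) = (m B)%:R.
Proof.
rewrite (eq_Ex trialE) -start_total.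
exact: (Ex_total_evolve _ good_child m_split alpha0 beta0 c_ge0 start_healthy coarse_range).
Qed.

(** The 64 in [N_large] comes from here: the growth y = 2 alpha beta / N per level satisfies 2 L y
    <= delta ^ 2 / 16, and this relative variance makes the failure probability in [trial_deviation]
    1/16. *)
Let Ex_trial_sqr :
  Ex (fun x => trial q s l B x ^+ 2) <= (1 + delta ^+ 2 / 16) * (m B)%:R ^+ 2.
Proof.
rewrite (eq_Ex (g := fun x => total m (final_population q s l B x) ^+ 2)) => [|x]; last first.
  by rewrite trialE.
apply: le_trans (Ex_total_evolve_sqr _ good_child m_split alpha0 beta0 c_ge0
  start_healthy coarse_range) _.
rewrite start_total ler_wpM2r ?sqr_ge0 //.
have N_gt0 : 0 < N%:R :> R by rewrite ltr0n.
set y := _ / N%:R.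
have y0 : 0 <= y.
  by apply: divr_ge0 (ltW N_gt0); apply: mulr_ge0 beta0; apply: mulr_ge0 alpha0.
have yN : 2 * L%:R * y <= delta ^+ 2 / 16.
  rewrite /y mulrA ler_pdivrMr // -subr_ge0.
  move: N_large; rewrite -subr_ge0; set t := _ - _; move=> t0.
  by rewrite (_ : _ - _ = t / 16) ?divr_ge0 // /t; field.
have delta2 : delta ^+ 2 / 16 <= 1 by have := delta0; have := delta4; nra.
apply: le_trans (expr_one_plus_le y0 (le_trans yN delta2)) _.
by rewrite lerD2l.
Qed.

Lemma trial_seed_gt0 : (0 < #|{: trial_seed}|)%N.
Proof.
by rewrite card_ffun expn_gt0 (generation_seed_gt0 ([ffun=> false] : signs) N0).
Qed.

Lemma trial_deviation :
  Ex (fun x => (~~ (`|trial q s l B x - (m B)%:R| <= delta * (m B)%:R))%:R)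
  <= 16^-1 :> R.
Proof.
set mu : R := (m B)%:R; have mu0 : 0 <= mu by exact: ler0n.
have var : Ex (fun x => (trial q s l B x - mu) ^+ 2) <= delta ^+ 2 / 16 * mu ^+ 2.
  rewrite (eq_Ex (g := fun x => trial q s l B x ^+ 2 +
     (- (2 * mu) * trial q s l B x + mu ^+ 2))) => [|x]; last by ring.
  rewrite !ExD ExZ Ex_trial Ex_cst ?trial_seed_gt0 // -/mu.
  by have := Ex_trial_sqr; rewrite -/mu; lra.
(* At mean 0 the deviation threshold vanishes and Chebyshev says nothing; instead the variance is 0,
   so every trial is exactly 0. *)
have [mu_eq|mu_neq] := eqVneq mu 0.
  have dev0 x : (trial q s l B x - mu) ^+ 2 = 0.
    move: x; apply: (Ex_eq0 trial_seed_gt0) => [x|]; first exact: sqr_ge0.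
    apply/eqP; rewrite eq_le Ex_ge0 ?andbT => [|x]; last exact: sqr_ge0.
    by move: var; rewrite {2}mu_eq expr0n mulr0.
  rewrite (eq_Ex (g := fun=> 0)) => [|x]; first by rewrite Ex_cst ?trial_seed_gt0 ?invr_ge0.
  have /eqP := dev0 x; rewrite sqrf_eq0 => /eqP ->.
  by rewrite normr0 mulr_ge0 // ltW.
have mu_gt0 : 0 < mu by rewrite lt_def mu_neq.
have a0 : 0 < (delta * mu) ^+ 2 by rewrite exprn_gt0 // mulr_gt0.
apply: le_trans (_ : _ <= Ex (fun x => (((delta * mu) ^+ 2 <
   (trial q s l B x - mu) ^+ 2)%R)%:R)) _.
  apply: le_Ex => x; rewrite ler_nat -ltNge.
  case: ltP => // lt; rewrite lt0b -[X in _ < X]real_normK ?num_real //.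
  by rewrite ltr_pXn2r ?nnegrE // mulr_ge0 // ltW.
apply: le_trans (markov_ex a0 _) _ => [x|]; first exact: sqr_ge0.
by rewrite ler_pdivrMr //; apply: le_trans var _; rewrite exprMn; lra.
Qed.

Lemma fine_count_deviation :
  Ex (fun w => (~~ (`|(fine_count q s w l B)%:R - (m B)%:R| <=
     3 * delta * (m B)%:R))%:R) <= (2 ^+ K)^-1 :> R.
Proof.
apply: le_trans (majority_bound K trial_seed_gt0 trial_deviation).
apply: le_Ex => w; rewrite ler_nat; case: (leqP K) => [_|lt]; first by case: (~~ _).
suff -> : `|(fine_count q s w l B)%:R - (m B)%:R| <= 3 * delta * (m B)%:R by [].
apply: consensus_close => //; [exact: ltW|exact: box_count_le|].
set A := [set _ | _] in lt; have := cardsC A; rewrite card_ord => cA.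
rewrite (_ : close_trials _ _ = ~: A); last first.
  by apply/setP => k; rewrite !inE negbK ffunE.
by move: lt cA; move: (#|A|) (#|~: A|) => a b; lia.
Qed.

End OneBox.

End ConsistentCoarse.

Definition counting_ok (s : coarse_seed U d0 L K) (w : fine_seed) : bool :=
  [forall l : 'I_L.+1, forall B : box, (B \in level_boxes U d l) ==>
    (`|(fine_count q s w l B)%:R - (box_count h B)%:R| <= 3 * delta * (box_count h B)%:R)].

Lemma coarse_seed_gt0 : (0 < #|{: coarse_seed U d0 L K}|)%N.
Proof. by rewrite card_ffun expn_gt0 card_coarse_seed1. Qed.

Lemma fine_seed_gt0 : (0 < #|{: fine_seed}|)%N.
Proof. by rewrite card_ffun expn_gt0 trial_seed_gt0. Qed.

Lemma counting_failure :
  Ex (fun sw : coarse_seed U d0 L K * fine_seed => (~~ counting_ok sw.1 sw.2)%:R) <=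
  ((2 * L).+1 * 2 ^ (d * (2 * L)) * (hash_size d L * (L * d).+1 * 2))%:R / 2 ^+ K +
  (L.+1 * (L.+1 * 2 ^ (d * L)))%:R / 2 ^+ K :> R.
Proof.
have K0 : 0 <= (2 ^+ K)^-1 :> R by rewrite invr_ge0 exprn_ge0.
rewrite Ex_pair.
pose bad (s : coarse_seed U d0 L K) := [exists B, (B \in boxes_below U d (2 * L).+1) && ~~ coarse_consistent chi h q s B].
set p2 := (X in _ + X).
(* The coarse seed is fixed first. Unless it is bad, the fine seed is still uniform, and only a
   union bound over the boxes of levels 0 to L remains. *)
apply: (@le_trans _ _ (Ex (fun s : coarse_seed U d0 L K => (bad s)%:R + p2))).
  apply: le_Ex => s; have [bs|/existsPn ok] := boolP (bad s).
    apply: (@le_trans _ _ 1); last by rewrite lerDl mulr_ge0.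
    by apply: Ex_le_cst fine_seed_gt0 _ _ _ => w; case: (~~ _).
  have cons B : B \in boxes_below U d (2 * L).+1 -> coarse_consistent chi h q s B.
    by move=> BN; have := ok B; rewrite BN /= negbK.
  rewrite add0r.
  pose I : finType := ('I_L.+1 * box)%type.
  pose P := [pred p : I | p.2 \in level_boxes U d p.1].
  pose Bad (p : I) (w : fine_seed) := ~~ (`|(fine_count q s w p.1 p.2)%:R -
     (box_count h p.2)%:R| <= 3 * delta * (box_count h p.2)%:R).
  have bnd (p : I) : P p -> Ex (fun w => (Bad p w)%:R) <= (2 ^+ K)^-1 :> R.
    by move=> Pp; apply: fine_count_deviation => //; rewrite -ltnS.
  apply: le_trans (le_trans (union_bound bnd) _).
    apply: le_Ex => w; rewrite ler_nat; have [|//] := boolP (~~ counting_ok s w).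
    move=> /forallPn[l /forallPn[B]]; rewrite negb_imply => /andP[Bl bad_lB].
    by rewrite lt0b; apply/existsP; exists (l, B); rewrite /P /Bad /= Bl.
  rewrite ler_wpM2r // ler_nat.
  apply: (@leq_trans #|setX [set: 'I_L.+1] (boxes_below U d L.+1)|).
    apply: subset_leq_card; apply/subsetP => p; rewrite !inE /= => pl.
    exact: boxes_belowP pl.
  by rewrite cardsX cardsT card_ord leq_mul2l card_boxes_below orbT.
rewrite ExD Ex_cst ?coarse_seed_gt0 // lerD2r.
apply: le_trans (coarse_inconsistent_le R K chi UL qE _) _.
by rewrite ler_wpM2r // ler_nat leq_mul2r card_boxes_below orbT.
Qed.

End FineCounting.

(** * Query costs and the random descent *)

Section CountingCost.
Variables (R : realType) (U : finType) (d0 L K N0 : nat) (delta : R).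
Local Notation d := d0.+1.
Local Notation N := N0.+1.
Local Notation box := {ffun 'I_d -> {set U}}.
Local Notation signs := {ffun 'I_d -> bool}.
Variable chi : {ffun 'I_(hash_size d L) -> colouring U d}.

Definition coarse_cost := (hash_size d L * K * L.+1 ^ d)%N.
Definition trial_cost := (L * (N * 2 ^ d * coarse_cost) + N)%N.
Definition fine_cost := (K * trial_cost)%N.

Lemma computable_coarse (s : coarse_seed U d0 L K) B :
  computable coarse_cost (fun O : cid_query U d -> bool =>
    (coarse_count chi (@query_or_false U d O) s B)%:R : R).
Proof.
apply: (computable_map (F := fun O => coarse_count chi (@query_or_false U d O) s B)).
apply: (computable_map (F := fun O =>
  [ffun p : probe_index d0 L K => query_or_false O (probe chi s B p)])).
rewrite /coarse_cost (_ : (_ * _ * _)%N = (#|probe_index d0 L K| * 1)%N).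
  by apply: (computable_table false) => p; exact: computable_query.
by rewrite muln1 !card_prod card_ffun !card_ord.
Qed.

Lemma computable_evolve (cO : (cid_query U d -> bool) -> box -> R) cost D l
    (P : population R box N0) x :
  (forall B, computable cost (fun O => cO O B)) ->
  computable (D * (N * 2 ^ d * cost)) (fun O =>
    evolve ([ffun=> false] : signs) (@subbox U d) (cO O) l P x (D := D)).
Proof.
move=> Hc; elim: D l P x => [|D IH] l P x; first exact: computable_cst.
rewrite mulSn.
apply: (computable_bind (F := fun O => offspring_coarse (@subbox U d) (cO O) l P)
  (G := fun ca O => evolve ([ffun=> false] : signs) (@subbox U d) (cO O) l.+1
     (resample [ffun=> false] (@subbox U d) l P ca (x ord0)) (ftail x))).
  have -> : (N * 2 ^ d = #|offspring signs N0|)%N.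
    by rewrite card_prod card_ffun !card_ord card_bool.
  by apply: (computable_table 0) => i; exact: Hc.
by move=> ca; exact: IH.
Qed.

Lemma computable_trial (s : coarse_seed U d0 L K) l B (x : trial_seed d0 L N0) :
  computable trial_cost (fun O => trial R chi (@query_or_false U d O) s l B x : R).
Proof.
apply: (computable_bind (F := fun O => final_population R chi (@query_or_false U d O) s l B x)
  (G := fun P O => weigh P [ffun k => query_or_false O (P k).2])).
  by apply: computable_evolve => B'; exact: computable_coarse.
move=> P; apply: (computable_map (F := fun O => [ffun k => query_or_false O (P k).2])).
apply: (@computable_le _ _ _ (#|'I_N| * 1)%N); first by rewrite card_ord muln1.
by apply: (computable_table false) => k; exact: computable_query.
Qed.

Lemma computable_fine (s : coarse_seed U d0 L K) w l B :
  computable fine_cost (fun O => @fine_count R U d0 L K N0 delta chi (@query_or_false U d O) s w l B).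
Proof.
apply: (computable_map (F := fun O =>
  [ffun k : 'I_K => trial R chi (@query_or_false U d O) s l B (w k)]) (consensus d0 L delta (K := K))).
apply: (@computable_le _ _ _ (#|'I_K| * trial_cost)%N); first by rewrite card_ord.
by apply: (computable_table 0) => k; exact: computable_trial.
Qed.

End CountingCost.

(** * Random descent to a hyperedge *)

Section Descent.
Variables (U : finType) (d0 L : nat).
Local Notation d := d0.+1.
Local Notation box := {ffun 'I_d -> {set U}}.
Local Notation signs := {ffun 'I_d -> bool}.

Definition weight_bound := (2 ^ d * 2 ^ (L * d))%N.

(* Divisible by every total weight up to weight_bound. *)
Definition choice_size := weight_bound`!.

(** Divisibility makes the probability of s exactly [y s] over the total. A rounding error could not
    be repaired here, as the output carries no weight. *)
Lemma exists_choice (y : {ffun signs -> nat}) :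
  exists f : {ffun 'I_choice_size -> signs},
    (0 < \sum_s y s <= weight_bound)%N ->
    forall s, (#|[set x | f x == s]| * \sum_s y s = y s * choice_size)%N.
Proof.
have [|bad] := boolP (0 < \sum_s y s <= weight_bound)%N; last first.
  by exists [ffun=> [ffun=> false]].
move=> /[dup] yW /dvdn_fact/dvdnP[z Hz].
have [|f Hf] := @exists_exact_fibres _ ([ffun=> false] : signs) (fun s => y s * z)%N choice_size.
  by rewrite -big_distrl /= mulnC -Hz.
by exists f => _ s; rewrite Hf /choice_size Hz mulnA.
Qed.

Definition choose_child y := projT1 (cid (exists_choice y)).

Fixpoint descend (e : nat -> box -> nat) D l (B : box) : {ffun 'I_D -> 'I_choice_size} -> box :=
  match D with
  | 0 => fun _ => B
  | D'.+1 => fun x => descend e l.+1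
     (subbox l B (choose_child [ffun s => e l.+1 (subbox l B s)] (x ord0))) (ftail x)
  end.

Definition box_vertices (B : box) : {set U} := \bigcup_i B i.

Lemma descend_in_box e D l B x t :
  in_box t (descend e (D := D) l B x) -> in_box t B.
Proof.
elim: D l B x => // D IH l B x /= /IH.
by rewrite in_subbox => /andP[].
Qed.

Lemma computable_descend (eO : (cid_query U d -> bool) -> nat -> box -> nat) cost D l B x :
  (forall l B, computable cost (fun O => eO O l B)) ->
  computable (D * (2 ^ d * cost)) (fun O => descend (eO O) (D := D) l B x).
Proof.
move=> He; elim: D l B x => [|D IH] l B x; first exact: computable_cst.
rewrite mulSn.
apply: (computable_bind (F := fun O => [ffun s => eO O l.+1 (subbox l B s)])
  (G := fun y O => descend (eO O) l.+1 (subbox l B (choose_child y (x ord0))) (ftail x))).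
  have -> : (2 ^ d = #|{: signs}|)%N by rewrite card_ffun !card_ord card_bool.
  by apply: (computable_table 0%N) => s; exact: He.
by move=> y; exact: IH.
Qed.

Variables (R : realType) (h : pred {ffun 'I_d -> U}) (q : box -> bool).
Variables (e : nat -> box -> nat) (rho : R).
Hypothesis UL : (#|U| <= 2 ^ L)%N.
Hypothesis hI : forall t, h t -> injective t.
Hypothesis qE : forall A, q A = disjoint_box A && [exists t, h t && in_box t A].
Hypothesis rho0 : 0 <= rho.
Hypothesis rho2 : rho <= 2^-1.
Hypothesis e_le : forall l B, (e l B <= 2 ^ (L * d))%N.
Hypothesis e_close : forall l B, (l <= L)%N -> B \in level_boxes U d l ->
  `|(e l B)%:R - (box_count h B)%:R| <= rho * (box_count h B)%:R.

Lemma choice_size_gt0 : (0 < choice_size)%N. Proof. exact: fact_gt0. Qed.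

Let seeds_gt0 D : (0 < #|{: {ffun 'I_D -> 'I_choice_size}}|)%N.
Proof. by rewrite card_ffun expn_gt0 card_ord choice_size_gt0. Qed.

Section OneStep.
Variables (l : nat) (B : box).
Hypotheses (lL : (l < L)%N) (Bl : B \in level_boxes U d l) (mB : (0 < box_count h B)%N).

Let y : {ffun signs -> nat} := [ffun s => e l.+1 (subbox l B s)].
Let m s : R := (box_count h (subbox l B s))%:R.

Let y_close s : (1 - rho) * m s <= (y s)%:R <= (1 + rho) * m s.
Proof.
have := e_close lL (level_boxesS s Bl); rewrite ffunE ler_norml /m.
by move=> /andP[? ?]; apply/andP; split; lra.
Qed.

Let sum_close : (1 - rho) * (box_count h B)%:R <= \sum_s (y s)%:R <=
   (1 + rho) * (box_count h B)%:R.
Proof.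
rewrite (box_count_split h l) natr_sum !mulr_sumr; apply/andP; split.
  by apply: ler_sum => s _; case/andP: (y_close s).
by apply: ler_sum => s _; case/andP: (y_close s).
Qed.

Let sum_gt0 : 0 < \sum_s (y s)%:R :> R.
Proof.
case/andP: sum_close => le _; apply: lt_le_trans le.
by rewrite mulr_gt0 ?ltr0n //; have := rho2; lra.
Qed.

Let sum_range : (0 < \sum_s y s <= weight_bound)%N.
Proof.
rewrite -(ltr0n R) natr_sum sum_gt0 /=.
apply: (@leq_trans (\sum_(s : signs) 2 ^ (L * d))).
  by apply: leq_sum => s _; rewrite ffunE.
by rewrite sum_nat_const card_ffun card_bool card_ord.
Qed.

Let choiceP s : (#|[set x | choose_child y x == s]| * \sum_s y s = y s * choice_size)%N.
Proof. by rewrite /choose_child; case: cid => f /= H; exact: H. Qed.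

(** A relative error forces the estimate of an empty child to be 0; its fibre is then empty, and the
    descent never enters it. *)
Lemma choose_child_gt0 x : (0 < box_count h (subbox l B (choose_child y x)))%N.
Proof.
set s := choose_child y x.
have : (0 < y s * choice_size)%N.
  rewrite -choiceP muln_gt0; case/andP: sum_range => -> _; rewrite andbT.
  by apply/card_gt0P; exists x; rewrite inE.
rewrite muln_gt0 => /andP[ys _]; rewrite lt0n; apply: contraTneq ys => m0.
have /andP[_] := y_close s; rewrite /m m0 mulr0 lern0 => /eqP ->.
by [].
Qed.

(** For rho <= 1/2, (1 - rho) / (1 + rho) >= 1 - 2 rho and (1 + rho) / (1 - rho) <= 1 + 4 rho. *)
Lemma choose_child_prob s : (0 < box_count h (subbox l B s))%N ->
  (1 - 2 * rho) * m s <=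
    Ex (fun x => (choose_child y x == s)%:R) * (box_count h B)%:R <=
  (1 + 4 * rho) * m s.
Proof.
move=> ms0; set p := Ex _; set S : R := \sum_s (y s)%:R.
have pE : p * S = (y s)%:R.
  rewrite /p /Ex card_ord.
  have -> : \sum_x (choose_child y x == s)%:R = #|[set x | choose_child y x == s]|%:R :> R.
    rewrite -sum1_card natr_sum [RHS]big_mkcond; apply: eq_bigr => x _.
    by rewrite inE; case: eqP.
  rewrite /S -natr_sum mulrAC -natrM choiceP natrM mulfK //.
  by rewrite pnatr_eq0 -lt0n choice_size_gt0.
have /andP[y1 y2] := y_close s; have := sum_close; rewrite -/S => /andP[S1 S2].
have ms0' : 0 < m s by rewrite ltr0n.
have mB' : 0 < (box_count h B)%:R :> R by rewrite ltr0n.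
have p0 : 0 <= p by apply: Ex_ge0 => x; rewrite ler0n.
move: pE y1 y2 S1 S2; set b := (box_count h B)%:R in mB' *.
set ys := (y s)%:R => pE y1 y2 S1 S2.
apply/andP; split.
  have : (1 - rho) * m s <= p * ((1 + rho) * b).
    by rewrite (le_trans y1) // -pE ler_wpM2l.
  have ? := rho0; have ? := rho2; nra.
have : p * ((1 - rho) * b) <= (1 + rho) * m s.
  by rewrite (le_trans _ y2) // -pE ler_wpM2l.
have ? := rho0; have ? := rho2; nra.
Qed.

End OneStep.

Lemma descend_level D l B x : B \in level_boxes U d l ->
  descend e (D := D) l B x \in level_boxes U d (l + D).
Proof.
elim: D l B x => [|D IH] l B x Bl; first by rewrite addn0.
by rewrite addnS -addSn; apply: IH; exact: level_boxesS.
Qed.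

Lemma descend_gt0 D l B x : (l + D <= L)%N -> B \in level_boxes U d l ->
  (0 < box_count h B)%N -> (0 < box_count h (descend e (D := D) l B x))%N.
Proof.
elim: D l B x => [|D IH] l B x lD Bl mB //=.
apply: IH; first by rewrite addSnnS.
  exact: level_boxesS.
by apply: choose_child_gt0 => //; lia.
Qed.

(** Each step has probability close to the count of the child over that of the parent; these ratios
    telescope from the count of [B] down to the count 1 of the leaf. *)
Lemma descend_prob D l B t : (l + D = L)%N -> B \in level_boxes U d l ->
  h t -> in_box t B ->
  (1 - 2 * rho) ^+ D <=
    Ex (fun x => (in_box t (descend e (D := D) l B x))%:R) * (box_count h B)%:R
  <= (1 + 4 * rho) ^+ D.
Proof.
move=> + + ht; elim: D l B => [|D IH] l B lD Bl tB.
  rewrite addn0 in lD; rewrite /= Ex_cst // tB mul1r !expr0.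
  have -> : box_count h B = 1%N.
    have := leaf_count UL hI qE (eq_leq (esym lD)) Bl.
    have : (0 < box_count h B)%N by apply/card_gt0P; exists t; rewrite inE ht tB.
    by case: (q B) => /= lt0 e0; rewrite e0 in lt0 *.
  by rewrite lexx.
set s := [ffun i => t i \in bit_set U l].
have ts : in_box t (subbox l B s) by rewrite in_subbox tB eqxx.
have lL : (l < L)%N by lia.
have mB : (0 < box_count h B)%N by apply/card_gt0P; exists t; rewrite inE ht tB.
have ms : (0 < box_count h (subbox l B s))%N by apply/card_gt0P; exists t; rewrite inE ht ts.
have lD' : (l.+1 + D = L)%N by lia.
have := IH l.+1 _ lD' (level_boxesS s Bl) ts.
have := choose_child_prob lL Bl mB ms.
set y := [ffun s => e l.+1 (subbox l B s)].
set p := Ex _; set p' := Ex (fun x => (in_box t (descend e l.+1 (subbox l B s) x))%:R).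
(* A step to any child other than [s] loses t for good, by [descend_in_box]. *)
have -> : Ex (fun x => (in_box t (descend e (D := D.+1) l B x))%:R) = p * p' :> R.
  rewrite Ex_fcons [p * _]mulrC -ExZ; apply: eq_Ex => x.
  have [xs|xs] := eqVneq (choose_child y x) s.
    by rewrite mulr1; apply: eq_Ex => x' /=; rewrite fcons0 fconsK -/y xs.
  rewrite mulr0 -[RHS](Ex_cst (seeds_gt0 D) 0); apply: eq_Ex => x' /=.
  rewrite fcons0 fconsK -/y; case: (boolP (in_box _ _)) => // /descend_in_box.
  by rewrite in_subbox tB /= -/s eq_sym (negPf xs).
set b := (box_count h B)%:R; set c := (box_count h (subbox l B s))%:R.
move=> /andP[p1 p2] /andP[c1 c2].
have p'0 : 0 <= p' by apply: Ex_ge0 => x; rewrite ler0n.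
have lo : 0 <= 1 - 2 * rho by have := rho2; lra.
have hi : 0 <= 1 + 4 * rho by have := rho0; lra.
rewrite !exprS; apply/andP; split.
  apply: (@le_trans _ _ ((1 - 2 * rho) * (p' * c))); first by rewrite ler_wpM2l.
  by have := ler_wpM2l p'0 p1; lra.
apply: (@le_trans _ _ ((1 + 4 * rho) * (p' * c))); last by rewrite ler_wpM2l.
by have := ler_wpM2l p'0 p2; lra.
Qed.

End Descent.

(** * Choice of the constants *)

Section Constants.
Variables (R : realType) (d0 : nat).
Local Notation d := d0.+1.

Definition hash_const := (d ^ d * (d + 1))%N.
(** The union bounds cost at most 2 ^ ((hash_const + 3 d + 3) L); the remaining d leaves a failure
    probability 2 ^ - (L d), which is at most n ^ -d because n <= 2 ^ L. *)
Definition rep_const := (hash_const + 4 * d + 10)%N.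

Definition repetitions L := (rep_const * L)%N.

Definition population_bound L (delta : R) : R :=
  64 * L%:R * (fine_alpha R d0 L * fine_beta R d0 L) / delta ^+ 2.

Definition population_size0 L (delta : R) := Num.truncn (population_bound L delta).

Lemma hash_size_le L : (0 < L)%N -> (hash_size d L <= hash_const * L)%N.
Proof.
move=> L0; rewrite /hash_size /hash_const -mulnA leq_mul2l; apply/orP; right; nia.
Qed.

Lemma failure_le L : (0 < L)%N ->
  ((2 * L).+1 * 2 ^ (d * (2 * L)) * (hash_size d L * (L * d).+1 * 2))%:R
    / 2 ^+ repetitions L +
  (L.+1 * (L.+1 * 2 ^ (d * L)))%:R / 2 ^+ repetitions L <= (2 ^+ (L * d))^-1 :> R.
Proof.
move=> L0; rewrite -mulrDl -natrD ler_pdivrMr ?exprn_gt0 //.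
rewrite mulrC ler_pdivlMr ?exprn_gt0 // -!natrX -natrM ler_nat.
have S_le k : (k.+1 <= 2 ^ k)%N by exact: ltn_expl.
have two_le : (2 <= 2 ^ L)%N by rewrite -{1}(expn1 2) leq_exp2l.
have hash_le : (hash_size d L <= 2 ^ (hash_const * L))%N.
  by apply: leq_trans (hash_size_le L0) _; exact/ltnW/S_le.
set A := (_ * (_ * 2))%N; set B := (L.+1 * _)%N.
have HA : (A <= 2 ^ (2 * L) * 2 ^ (d * (2 * L)) * (2 ^ (hash_const * L) * 2 ^ (L * d) * 2 ^ L))%N.
  apply: leq_mul; first exact: leq_mul (S_le _) (leqnn _).
  exact: leq_mul (leq_mul hash_le (S_le _)) two_le.
have HB : (B <= 2 ^ L * (2 ^ L * 2 ^ (d * L)))%N.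
  exact: leq_mul (S_le _) (leq_mul (S_le _) (leqnn _)).
rewrite -!expnD in HA HB.
have -> : (2 ^ repetitions L = 2 ^ (rep_const * L - L * d - 1) * 2 * 2 ^ (L * d))%N.
  rewrite -expnSr -expnD /repetitions /rep_const; congr (_ ^ _)%N; nia.
rewrite leq_mul2r; apply/orP; right; rewrite muln2 -addnn; apply: leq_add.
  by apply: leq_trans HA _; rewrite leq_exp2l // /rep_const; nia.
by apply: leq_trans HB _; rewrite leq_exp2l // /rep_const; nia.
Qed.

Lemma population_size_large L (delta : R) : 0 < delta ->
  64 * L%:R * (fine_alpha R d0 L * fine_beta R d0 L) <=
  delta ^+ 2 * (population_size0 L delta).+1%:R.
Proof.
move=> delta0; have d2 : 0 < delta ^+ 2 by rewrite exprn_gt0.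
have b0 : 0 <= population_bound L delta.
  rewrite /population_bound /fine_alpha /fine_beta.
  by rewrite !(mulr_ge0, invr_ge0, exprn_ge0) // ltW.
have /andP[_] := truncn_itv b0; rewrite -/(population_size0 L delta).
by move/ltW; rewrite [delta ^+ 2 * _]mulrC -ler_pdivrMr.
Qed.

Definition ratio_const := (64 * (64 * d * (d + 1)) ^ d * 2 ^ d0 * hash_const)%N.
Definition coarse_const := (hash_const * rep_const * 2 ^ d)%N.
Definition cost_const := (rep_const * (2 ^ d * coarse_const + 1) * (128 * ratio_const))%N.

Lemma ratio_const_gt0 : (0 < ratio_const)%N.
Proof. by rewrite !muln_gt0 !expn_gt0 !muln_gt0 addn1. Qed.

Lemma cost_const_gt0 : (0 < cost_const)%N.
Proof.
rewrite /cost_const muln_gt0 [(0 < 128 * _)%N]muln_gt0 ratio_const_gt0 !andbT.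
by rewrite muln_gt0 addn1 /rep_const addnS.
Qed.

(** The exponent 2 d is d from [thin_const] ^ d, d - 1 from the choices of exponents and 1 from the
    number of colourings. *)
Lemma ratio_le L : (0 < L)%N ->
  fine_alpha R d0 L * fine_beta R d0 L <= ratio_const%:R * L%:R ^+ (2 * d).
Proof.
move=> L0; rewrite /fine_alpha /fine_beta -!natrX -!natrM ler_nat.
have t_le : (thin_const d0 L <= 64 * d * (d + 1) * L)%N.
  by rewrite /thin_const -[leqRHS]mulnA leq_mul2l; apply/orP; right; nia.
have S_le : (L.+1 <= 2 * L)%N by lia.
apply: (@leq_trans (2 * (64 * d * (d + 1) * L) ^ d *
    (32 * (2 * L) ^ d0 * (hash_const * L))))%N.
  have pow_le a b e : (a <= b)%N -> (a ^ e <= b ^ e)%N.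
    by case: e => // e ab; rewrite leq_exp2r.
  apply: leq_mul; first exact: leq_mul (leqnn 2) (pow_le _ _ _ t_le).
  exact: leq_mul (leq_mul (leqnn 32) (pow_le _ _ _ S_le)) (hash_size_le L0).
rewrite !expnMn /ratio_const (_ : (2 * d = d + d0 + 1)%N); last by lia.
rewrite !expnD expn1 !expnMn; apply/eq_leq; ring.
Qed.

Lemma fine_cost_le L (delta : R) : (0 < L)%N -> 0 < delta -> delta <= 1 ->
  (fine_cost d0 L (repetitions L) (population_size0 L delta))%:R <=
  cost_const%:R * L%:R ^+ (3 * d + 5) / delta ^+ 2.
Proof.
move=> L0 delta0 delta1; set N := (population_size0 L delta).+1.
have d2 : 0 < delta ^+ 2 by rewrite exprn_gt0.
have L1 : 1 <= L%:R :> R by rewrite ler1n.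
have N_le : N%:R <= (128 * ratio_const)%:R * L%:R ^+ (2 * d + 1) / delta ^+ 2 :> R.
  rewrite ler_pdivlMr //.
  have /andP[le _] : (population_size0 L delta)%:R <= population_bound L delta
      < (population_size0 L delta).+1%:R.
    apply: truncn_itv; rewrite /population_bound /fine_alpha /fine_beta.
    by rewrite !(mulr_ge0, invr_ge0, exprn_ge0) // ltW.
  have {}le : (population_size0 L delta)%:R * delta ^+ 2 <=
      64 * (ratio_const%:R * L%:R ^+ (2 * d + 1)).
    rewrite -ler_pdivlMr //; apply: le_trans le _; rewrite /population_bound.
    rewrite ler_wpM2r ?invr_ge0 ?(ltW d2) // -mulrA ler_wpM2l //.
    by rewrite exprD expr1 [leLHS]mulrC [leRHS]mulrA ler_wpM2r ?ratio_le.
  (* As delta <= 1, the unit added to make N an integer at most doubles 64 to 128. *)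
  have one_le : delta ^+ 2 <= 64 * (ratio_const%:R * L%:R ^+ (2 * d + 1)).
    apply: (@le_trans _ _ 1); first by rewrite exprn_ile1 // ltW.
    rewrite mulrA; apply: mulr_ege1; last exact: exprn_ege1.
    by rewrite -natrM ler1n muln_gt0 ratio_const_gt0.
  by rewrite -[N%:R]natr1 mulrDl mul1r natrM; lra.
have cost_nat : (fine_cost d0 L (repetitions L) (population_size0 L delta) <=
   rep_const * (2 ^ d * coarse_const + 1) * L ^ (d + 4) * N)%N.
  rewrite /fine_cost /trial_cost -/N /repetitions.
  have c_le : (coarse_cost d0 L (repetitions L) <= coarse_const * L ^ (d + 2))%N.
    rewrite /coarse_cost /coarse_const /repetitions.
    have S_le : (L.+1 ^ d <= (2 * L) ^ d)%N by rewrite leq_exp2r //; lia.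
    apply: (@leq_trans (hash_const * L * (rep_const * L) * (2 * L) ^ d)%N).
      by rewrite leq_mul // leq_mul // hash_size_le.
    by rewrite expnMn expnD; apply/eq_leq; ring.
  have L_pow : (1 <= L ^ (d + 3))%N by rewrite expn_gt0 L0.
  apply: (@leq_trans (rep_const * L * (L * (N * 2 ^ d * (coarse_const * L ^ (d + 2))) +
     N * L ^ (d + 3)))%N).
    rewrite leq_mul2l leq_add ?orbT //; first by rewrite !leq_mul2l c_le !orbT.
    by rewrite leq_pmulr.
  by rewrite !expnD; apply/eq_leq; ring.
apply: (@le_trans _ _ ((rep_const * (2 ^ d * coarse_const + 1))%:R * L%:R ^+ (d + 4) * N%:R)).
  by rewrite -natrX -!natrM ler_nat.
apply: (@le_trans _ _ ((rep_const * (2 ^ d * coarse_const + 1))%:R * L%:R ^+ (d + 4) *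
   ((128 * ratio_const)%:R * L%:R ^+ (2 * d + 1) / delta ^+ 2))).
  by rewrite ler_wpM2l // mulr_ge0 ?exprn_ge0.
rewrite /cost_const [in leRHS]natrM (_ : (3 * d + 5 = (d + 4) + (2 * d + 1))%N); last by lia.
rewrite [in leRHS]exprD le_eqVlt; apply/orP; left; apply/eqP.
by rewrite [LHS]mulrA mulrACA.
Qed.

End Constants.

(** * The two algorithms *)

Section Algorithms.
Variables (R : realType) (U : finType) (d0 : nat).
Local Notation d := d0.+1.
Local Notation box := {ffun 'I_d -> {set U}}.

Lemma rand_alg_of_computable (S : finType) T (F : S -> (cid_query U d -> bool) -> T) cost :
  (forall w, computable cost (F w)) ->
  exists tr : S -> decision_tree U d T, forall w O,
    tree_output O (tr w) = F w O /\ (tree_queries O (tr w) <= cost)%N.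
Proof. by move=> /choice[tr Htr]; exists tr. Qed.

Hypothesis U2 : (1 < #|U|)%N.

Let L := up_log 2 #|U|.

Lemma levels_gt0 : (0 < L)%N. Proof. by rewrite up_log_gt0. Qed.

Lemma card_le_levels : (#|U| <= 2 ^ L)%N. Proof. exact: up_logP. Qed.

Let ell : R := log2 #|U|%:R.

Lemma ln2_gt0 : 0 < ln 2 :> R. Proof. by rewrite ln_gt0 // ltr1n. Qed.

(** Rounding up adds at most 1, and 1 <= log n since n >= 2. *)
Lemma levels_le_log : L%:R <= 2 * ell.
Proof.
have U0 : 0 < #|U|%:R :> R by rewrite ltr0n ltnW.
have ell1 : 1 <= ell.
  by rewrite /ell /log2 ler_pdivlMr ?ln2_gt0 // mul1r ler_ln ?posrE // ler_nat.
suff : L.-1%:R <= ell.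
  by have := levels_gt0; case: (L) => // l _ /=; rewrite -[l.+1%:R]natr1; lra.
rewrite /ell /log2 ler_pdivlMr ?ln2_gt0 // mulr_natl -lnXn // ler_ln ?posrE ?exprn_gt0 //.
have /andP[le _] := up_log_bounds (isT : (1 < 2)%N) U2.
by rewrite -natrX ler_nat ltnW.
Qed.

Lemma log_pow_le k : L%:R ^+ k <= 2 ^+ k * ell ^+ k.
Proof. by rewrite -exprMn lerXn2r ?nnegrE ?(le_trans _ levels_le_log). Qed.

Lemma success_bound_le (p : R) : p <= (2 ^+ (L * d))^-1 ->
  success_bound (1 : R) #|U| d <= 1 - p.
Proof.
move=> le; rewrite /success_bound mul1r powR_mulrn // lerD2l lerN2.
apply: le_trans le _; rewrite lef_pV2 ?posrE ?exprn_gt0 ?ltr0n ?(ltnW U2) //.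
by rewrite exprM lerXn2r ?nnegrE ?exprn_ge0 // -natrX ler_nat card_le_levels.
Qed.

Lemma success_bound_gt0 : 0 < success_bound (1 : R) #|U| d.
Proof.
rewrite /success_bound mul1r powR_mulrn // subr_gt0 invf_lt1 ?exprn_gt0 ?ltr0n ?(ltnW U2) //.
by rewrite exprn_egt1 // ltr1n.
Qed.

Let K := repetitions d0 L.

Section Precision.
Variable delta : R.
Hypotheses (delta_gt0 : 0 < delta) (delta_le : delta <= 4^-1).

Let N0 := population_size0 d0 L delta.

Definition counting_seed : finType :=
  (coarse_seed U d0 L K * fine_seed d0 L K N0)%type.

Lemma counting_seed_gt0 : (0 < #|counting_seed|)%N.
Proof. by rewrite card_prod muln_gt0 coarse_seed_gt0 fine_seed_gt0. Qed.

Variable chi : {ffun 'I_(hash_size d L) -> colouring U d}.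
Hypothesis chiP : forall tau : {ffun 'I_d -> U}, injective tau ->
      exists k, forall i, chi k (tau i) = i.

Definition count_estimate O (w : counting_seed) l (B : box) : nat :=
  fine_count delta chi (@query_or_false U d O) w.1 w.2 l B.

Definition estimates_ok (H : hypergraph U d) (w : counting_seed) : bool :=
  counting_ok delta chi (ordered_edge H) (query_or_false (cid_oracle H)) w.1 w.2.

Lemma estimates_fail H :
  Ex (fun w => (~~ estimates_ok H w)%:R) <= (2 ^+ (L * d))^-1 :> R.
Proof.
apply: le_trans (failure_le R d0 levels_gt0).
apply: counting_failure => //.
- exact: card_le_levels.
- exact: query_or_falseE.
- by move=> t; exact: ordered_edge_inj.
- exact: population_size_large.
Qed.

Lemma estimates_okP H w l B : estimates_ok H w -> (l <= L)%N -> B \in level_boxes U d l ->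
  `|(count_estimate (cid_oracle H) w l B)%:R - (box_count (ordered_edge H) B)%:R|
    <= 3 * delta * (box_count (ordered_edge H) B)%:R.
Proof.
move=> /forallP ok lL Bl.
by have /forallP/(_ B) := ok (Ordinal (lL : (l < L.+1)%N)); rewrite Bl.
Qed.

End Precision.

Lemma estimator_exists (eps : R) : 0 < eps < 1 ->
  exists alg : rand_alg U d R, forall H : hypergraph U d,
    solves_estimation 1 eps H alg /\
    query_cost_le ((16 * cost_const d0 * 2 ^ (3 * d + 5))%:R * ell ^+ (3 * d + 5) / eps ^+ 2)
      H alg.
Proof.
(* The final error is 3 delta, below eps; the 4 also yields delta <= 1/4, and its square is the 16
   in the cost. *)
move=> /andP[eps0 eps1]; pose delta := eps / 4.
have delta0 : 0 < delta by rewrite divr_gt0.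
have delta4 : delta <= 4^-1 by rewrite /delta; lra.
have [chi chiP] := exists_hash_family (isT : (0 < d)%N) card_le_levels.
pose S := counting_seed delta.
pose F (w : S) O : R := (count_estimate chi O w 0 (full_box U d))%:R / d`!%:R.
have [w|tr Htr] := rand_alg_of_computable (F := F)
    (cost := fine_cost d0 L K (population_size0 d0 L delta)).
  apply: (computable_map (F := fun O => count_estimate chi O w 0 (full_box U d))
    (fun y => y%:R / d`!%:R)); exact: computable_fine.
exists (RandAlg (counting_seed_gt0 delta) tr) => H; split; last first.
  move=> w; have [_ le] := Htr w (cid_oracle H).
  apply: (@le_trans _ _ (fine_cost d0 L K (population_size0 d0 L delta))%:R).
    by rewrite ler_nat.
  apply: le_trans (fine_cost_le d0 levels_gt0 delta0 _) _; first by lra.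
  have -> : (cost_const d0)%:R * L%:R ^+ (3 * d + 5) / delta ^+ 2 =
      16 * (cost_const d0)%:R * L%:R ^+ (3 * d + 5) / eps ^+ 2.
    by rewrite /delta; field; rewrite gt_eqF.
  rewrite ler_wpM2r ?invr_ge0 ?exprn_ge0 ?(ltW eps0) //.
  move: (cost_const d0) => c0; rewrite !natrM natrX -!mulrA.
  by rewrite !ler_wpM2l // log_pow_le.
apply: le_trans (success_bound_le (estimates_fail delta0 delta4 chiP H)) _.
rewrite Ex_compl ?counting_seed_gt0 // subKr Ex_unif_pr; apply: le_Ex => w.
rewrite ler_nat inE; case ok: (estimates_ok _ _ _) => //=; rewrite lt0b.
have [out _] := Htr w (cid_oracle H).
rewrite /alg_output /= out /F.
have := estimates_okP ok (leq0n _) (set11 (full_box U d)).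
rewrite full_box_count -cardsE card_ordered_edges natrM.
have f0 : 0 < d`!%:R :> R by rewrite ltr0n fact_gt0.
set y := (count_estimate _ _ _ _ _)%:R; set m := (num_hyperedges H)%:R.
have m0 : 0 <= m by exact: ler0n.
move=> le; rewrite -(ler_pM2l f0) -{1}(gtr0_norm f0) -normrM mulrBr mulrC divfK ?gt_eqF //.
apply: le_trans le _; rewrite /delta.
have : 0 <= eps * (d`!%:R * m) by rewrite !mulr_ge0 // ltW.
lra.
Qed.

Lemma sampler_exists (eps : R) : 0 < eps < 1 ->
  exists alg : rand_alg U d {set U}, forall H : hypergraph U d,
    solves_sampling 1 eps H alg /\
    query_cost_le ((2 ^ d * 576 * cost_const d0 * 2 ^ (3 * d + 8))%:R *
       ell ^+ (3 * d + 8) / eps ^+ 2) H alg.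
Proof.
(* With rho = 3 delta, (1 + 4 rho) ^ L <= 1 + 8 L rho = 1 + 24 L delta = 1 + eps. The 576 in the
   cost is 24 ^ 2. *)
move=> /andP[eps0 eps1]; pose delta := eps / (24 * L%:R).
have L0 : 0 < L%:R :> R by rewrite ltr0n levels_gt0.
have L1 : 1 <= L%:R :> R by rewrite ler1n levels_gt0.
have delta0 : 0 < delta by rewrite divr_gt0 // mulr_gt0.
have delta_eps : 24 * L%:R * delta = eps by rewrite mulrC divfK // gt_eqF ?mulr_gt0.
have delta4 : delta <= 4^-1 by nra.
have [chi chiP] := exists_hash_family (isT : (0 < d)%N) card_le_levels.
pose X : finType := {ffun 'I_L -> 'I_(choice_size d0 L)}.
have X0 : (0 < #|X|)%N by rewrite card_ffun expn_gt0 card_ord choice_size_gt0.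
pose S : finType := (counting_seed delta * X)%type.
have S0 : (0 < #|S|)%N by rewrite card_prod muln_gt0 counting_seed_gt0.
pose walk O (w : S) := descend (count_estimate chi O w.1) 0 (full_box U d) w.2.
pose F (w : S) O : {set U} := box_vertices (walk O w).
pose cost := (L * (2 ^ d * fine_cost d0 L K (population_size0 d0 L delta)))%N.
have [w|tr Htr] := rand_alg_of_computable (F := F) (cost := cost).
  apply: (computable_map (F := fun O => walk O w) (@box_vertices U d0)).
  apply: (computable_descend (eO := fun O => count_estimate chi O w.1)) => l B.
  exact: computable_fine.
exists (RandAlg S0 tr) => H; split; last first.
  move=> w; have [_ le] := Htr w (cid_oracle H).
  apply: (@le_trans _ _ cost%:R); first by rewrite ler_nat.
  apply: (@le_trans _ _ (L%:R * (2 ^+ d * ((cost_const d0)%:R * L%:R ^+ (3 * d + 5) / delta ^+ 2)))).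
    rewrite /cost natrM ler_wpM2l // natrM natrX ler_wpM2l ?exprn_ge0 //.
    by apply: fine_cost_le => //; [exact: levels_gt0|lra].
  have -> : L%:R * (2 ^+ d * ((cost_const d0)%:R * L%:R ^+ (3 * d + 5) / delta ^+ 2)) =
      2 ^+ d * 576 * (cost_const d0)%:R * L%:R ^+ (3 * d + 8) / eps ^+ 2.
    rewrite -delta_eps (_ : 3 * d + 8 = 3 + (3 * d + 5))%N; last by lia.
    rewrite [in RHS]exprD; field.
    by rewrite !gt_eqF.
  rewrite ler_wpM2r ?invr_ge0 ?exprn_ge0 ?(ltW eps0) //.
  move: (cost_const d0) => c0; rewrite !natrM !natrX -!mulrA.
  by rewrite !ler_wpM2l ?exprn_ge0 // log_pow_le.
move=> H0; pose h := ordered_edge H; pose q := query_or_false (cid_oracle H).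
pose ok (w : counting_seed delta) := estimates_ok chi H w.
(* The event concerns the counting seed alone, so conditioning on it leaves the seed of the walk
   uniform. *)
pose G : {set S} := [set w | ok w.1].
have outE w : alg_output (alg := RandAlg S0 tr) H w = box_vertices (walk (cid_oracle H) w).
  by rewrite /alg_output /=; have [-> _] := Htr w (cid_oracle H).
have hI t : h t -> injective t by exact: ordered_edge_inj.
have qE : forall A, q A = disjoint_box A && [exists t, h t && in_box t A].
  exact: query_or_falseE.
have card_h : #|h| = (d`! * num_hyperedges H)%N by rewrite -card_ordered_edges cardsE.
have full_gt0 : (0 < box_count h (full_box U d))%N.
  by rewrite full_box_count card_h muln_gt0 fact_gt0.
have full0 : full_box U d \in level_boxes U d 0 by exact: set11.
pose rho := 3 * delta.
have rho0 : 0 <= rho by rewrite /rho; lra.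
have rho2 : rho <= 2^-1 by rewrite /rho; nra.
have e_le w l B : (count_estimate (delta := delta) chi (cid_oracle H) w l B <= 2 ^ (L * d))%N.
  exact: consensus_le.
have leaf_uniq w i u v : u \in walk (cid_oracle H) w i ->
    v \in walk (cid_oracle H) w i -> u = v.
  have lev := descend_level (count_estimate chi (cid_oracle H) w.1) w.2 full0.
  by move=> ui vi; have := leaf_inj card_le_levels (leqnn L) lev ui vi.
have end_box w : w \in G -> exists2 t, h t & forall t', h t' ->
    in_box t' (walk (cid_oracle H) w) = (t' == t).
  rewrite inE => okw.
  have close l B := @estimates_okP delta chi H w.1 l B okw.
  have := descend_gt0 (l := 0) card_le_levels rho0 rho2 (e_le w.1) close w.2 (leqnn L) full0 full_gt0.
  rewrite -/(walk _ _) => /card_gt0P[t]; rewrite inE => /andP[ht tw].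
  exists t => // t' _; apply/idP/eqP => [t'w|-> //]; apply/ffunP => i.
  move/in_boxP: tw => /(_ i) ti; move/in_boxP: t'w => /(_ i) t'i.
  exact: leaf_uniq t'i ti.
have out_set w t : w \in G -> h t -> in_box t (walk (cid_oracle H) w) ->
    alg_output (alg := RandAlg S0 tr) H w = [set t i | i in setT].
  move=> wG ht /in_boxP tw; rewrite outE; apply/setP => u.
  apply/bigcupP/imsetP => [[i _ ui]|[i _ ->]]; last by exists i.
  by exists i => //; exact: leaf_uniq ui (tw i).
have GE : unif_pr R G = Ex (fun w => (ok w)%:R).
  rewrite Ex_unif_pr Ex_pair; apply: eq_Ex => w.
  by rewrite -[RHS](Ex_cst X0); apply: eq_Ex => x; rewrite inE.
have G_succ : success_bound 1 #|U| d <= unif_pr R G.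
  apply: le_trans (success_bound_le (estimates_fail delta0 delta4 chiP H)) _.
  by rewrite Ex_compl ?counting_seed_gt0 // subKr GE.
have G_gt0 : 0 < unif_pr R G by apply: lt_le_trans G_succ; exact: success_bound_gt0.
exists G; split=> //.
  move=> w wG; have [t ht tw] := end_box w wG.
  by rewrite (out_set w t) // ?tw //; case/andP: ht.
move=> e eH; rewrite /unif_cond_pr (ler_pdivlMr _ _ G_gt0) (ler_pdivrMr _ _ G_gt0).
(* The d! orderings of [e] are reached in disjoint events, each of probability close to 1 / (d! m);
   their sum is close to 1 / m. *)
pose T := [pred t | h t && ([set t i | i in setT] == e)].
have cT : #|T| = d`! by rewrite -(card_orderings eH) cardsE.
have out_sum w : w \in G -> (alg_output (alg := RandAlg S0 tr) H w == e)%:R =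
    \sum_(t | T t) (in_box t (walk (cid_oracle H) w))%:R :> R.
  move=> wG; have [t0 ht0 t0w] := end_box w wG.
  rewrite (out_set w t0) ?t0w //.
  have [e0|ne] := eqVneq [set t0 i | i in setT] e.
    rewrite (bigD1 t0) /=; last by rewrite ht0 e0 eqxx.
    rewrite t0w // eqxx big1 ?addr0 // => t /andP[/andP[ht _] /negPf tt0].
    by rewrite t0w // tt0.
  rewrite big1 // => t /andP[ht /eqP te]; rewrite t0w //.
  by case: eqP => // tt0; rewrite -te tt0 eqxx in ne.
pose hit_prob w t := Ex (fun x => (in_box t (walk (cid_oracle H) (w, x)))%:R) : R.
have prE : unif_pr R ([set w | alg_output (alg := RandAlg S0 tr) H w == e] :&: G) =
    Ex (fun w => (ok w)%:R * \sum_(t | T t) hit_prob w t).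
  rewrite Ex_unif_pr Ex_pair; apply: eq_Ex => w; case okw: (ok w); last first.
    rewrite mul0r -[RHS](Ex_cst X0); apply: eq_Ex => x.
    by rewrite !inE /= okw andbF.
  rewrite mul1r -Ex_sum; apply: eq_Ex => x; rewrite -out_sum ?inE //.
  by rewrite /= okw andbT.
set m := (num_hyperedges H)%:R.
have m0 : 0 < m :> R by rewrite ltr0n.
have f0 : 0 < d`!%:R :> R by rewrite ltr0n fact_gt0.
have bern_lo : 1 - eps <= (1 - 2 * rho) ^+ L.
  have rho_le1 : 2 * rho <= 1 by lra.
  have eps_eq : L%:R * (2 * rho) = eps / 4 by rewrite -delta_eps /rho; field.
  apply: (@le_trans _ _ (1 - L%:R * (2 * rho))); first by rewrite eps_eq; lra.
  have bernoulli n : 1 - n%:R * (2 * rho) <= (1 - 2 * rho) ^+ n.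
    elim: n => [|n IH]; first by rewrite mul0r subr0.
    apply: (@le_trans _ _ ((1 - n%:R * (2 * rho)) * (1 - 2 * rho))).
      rewrite -[n.+1%:R]natr1; have : 0 <= n%:R * (2 * rho) ^+ 2 by rewrite mulr_ge0 ?exprn_ge0 // mulr_ge0.
      by rewrite expr2; lra.
    by rewrite exprSr ler_wpM2r // subr_ge0.
  exact: bernoulli.
have bern_hi : (1 + 4 * rho) ^+ L <= 1 + eps.
  apply: le_trans (expr_one_plus_le _ _) _; rewrite /rho; nra.
have each w t : ok w -> T t ->
    (1 - eps) / (d`!%:R * m) <= hit_prob w t <= (1 + eps) / (d`!%:R * m).
  move=> okw /andP[ht _].
  have close l B := @estimates_okP delta chi H w l B okw.
  have tfull : in_box t (full_box U d) by apply/in_boxP => i; rewrite ffunE inE.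
  have := descend_prob card_le_levels hI qE rho0 rho2 (e_le w) close (add0n L) full0 ht tfull.
  rewrite full_box_count card_h natrM -/m -/(hit_prob w t) => /andP[lo hi].
  rewrite ler_pdivrMr ?mulr_gt0 // ler_pdivlMr ?mulr_gt0 //.
  by rewrite (le_trans bern_lo lo) (le_trans hi bern_hi).
have sum_cst (c : R) : \sum_(t | T t) c / (d`!%:R * m) = c / m.
  rewrite sumr_const cT -[_ *+ _]mulr_natr; field; rewrite !gt_eqF //.
rewrite prE GE -!ExZ; apply/andP; split; apply: le_Ex => w.
  case okw: (ok w); last by rewrite mulr0 mul0r.
  rewrite mulr1 mul1r -sum_cst.
  by apply: ler_sum => t Tt; case/andP: (each w t okw Tt).
case okw: (ok w); last by rewrite mulr0 mul0r.
rewrite mulr1 mul1r -sum_cst.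
by apply: ler_sum => t Tt; case/andP: (each w t okw Tt).
Qed.

End Algorithms.

(** * Fewer than d vertices *)

Section SmallVertexSet.
Variables (R : realType) (U : finType) (d : nat).
Hypothesis Ud : (#|U| < d)%N.

Lemma few_vertices_no_edge (H : hypergraph U d) : num_hyperedges H = 0%N.
Proof.
apply/eqP; rewrite cards_eq0; apply/eqP/setP => e; rewrite inE.
by apply/negP => eH; have := max_card e; rewrite (card_hyperedge eH) leqNgt Ud.
Qed.

Lemma unit_seed_gt0 : (0 < #|{: unit}|)%N. Proof. by rewrite card_unit. Qed.

Definition constant_alg T (x : T) : rand_alg U d T :=
  RandAlg unit_seed_gt0 (fun=> Output _ _ x).

Lemma constant_alg_cost T (x : T) (b : R) H : 0 <= b -> query_cost_le b H (constant_alg x).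
Proof. by move=> b0 w. Qed.

Lemma constant_alg_estimates (eps : R) H : solves_estimation 1 eps H (constant_alg (0 : R)).
Proof.
rewrite /solves_estimation few_vertices_no_edge mulr0.
rewrite (_ : [set _ | _] = setT); last first.
  by apply/setP => w; rewrite !inE subr0 normr0 lexx.
rewrite /unif_pr cardsT divff ?pnatr_eq0 -?lt0n ?card_unit //.
by rewrite /success_bound gerBl invr_ge0 powR_ge0.
Qed.

End SmallVertexSet.

Lemma log2_ge0 (R : realType) n : (0 < n)%N -> 0 <= log2 (n%:R : R).
Proof. by move=> n0; rewrite /log2 divr_ge0 ?ln_ge0 ?ler1n. Qed.

Theorem theorem2 (R : realType) :
  exists2 c : R, 0 < c &
  forall d : nat, (2 <= d)%N ->
    (exists2 C : R, 0 < C &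
     exists estimator : forall U : finType, R -> rand_alg U d R,
     forall (U : finType) (eps : R), (0 < #|U|)%N -> 0 < eps < 1 ->
     forall H : hypergraph U d,
       solves_estimation c eps H (estimator U eps) /\
       query_cost_le (C * log2 #|U|%:R ^+ (3 * d + 5) / eps ^+ 2) H
         (estimator U eps))
    /\
    (exists2 C : R, 0 < C &
     exists sampler : forall U : finType, R -> rand_alg U d {set U},
     forall (U : finType) (eps : R), (0 < #|U|)%N -> 0 < eps < 1 ->
     forall H : hypergraph U d,
       solves_sampling c eps H (sampler U eps) /\
       query_cost_le (C * log2 #|U|%:R ^+ (3 * d + 9) / eps ^+ 2) H
         (sampler U eps)).
Proof.
exists 1 => // d; case: d => // d0 d2; set d := d0.+1.
have cost0 := cost_const_gt0 d0.
have cost_ge0 (U : finType) (eps C : R) k : (0 < #|U|)%N -> 0 <= C ->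
    0 <= C * log2 #|U|%:R ^+ k / eps ^+ 2.
  move=> U0 C0; apply: divr_ge0 (sqr_ge0 _); apply: mulr_ge0 => //.
  by rewrite exprn_ge0 ?log2_ge0.
split.
- pose C : R := (16 * cost_const d0 * 2 ^ (3 * d + 5))%:R.
  have C0 : 0 < C by rewrite ltr0n muln_gt0 expn_gt0 andbT muln_gt0 cost0.
  exists C => //.
  have ex (U : finType) (eps : R) : exists alg : rand_alg U d R,
      (0 < #|U|)%N -> 0 < eps < 1 -> forall H : hypergraph U d,
        solves_estimation 1 eps H alg /\
        query_cost_le (C * log2 #|U|%:R ^+ (3 * d + 5) / eps ^+ 2) H alg.
    (* A default outside the range of [eps] makes the family of algorithms total. *)
    have [eps01|] := boolP (0 < eps < 1); last first.
      by exists (constant_alg U d 0).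
    (* On a single vertex log n = 0 leaves a budget of no queries; since d >= 2 there is no
       hyperedge, and a constant answer is right. *)
    have [U1|U2] := leqP #|U| 1.
      exists (constant_alg U d 0) => U0 _ H; split.
        by apply: constant_alg_estimates; exact: leq_ltn_trans U1 d2.
      by apply: constant_alg_cost; rewrite cost_ge0 // ltW.
    have [alg Halg] := estimator_exists d0 U2 eps01.
    by exists alg => _ _ H; exact: Halg.
  exists (fun U eps => projT1 (cid (ex U eps))) => U eps U0 eps01 H.
  by case: cid => alg /= Halg; exact: Halg.
- pose C : R := (2 ^ d * 576 * cost_const d0 * 2 ^ (3 * d + 8))%:R.
  have C0 : 0 < C by rewrite ltr0n muln_gt0 expn_gt0 andbT muln_gt0 cost0 muln_gt0 expn_gt0.
  exists C => //.
  have ex (U : finType) (eps : R) : exists alg : rand_alg U d {set U},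
      (0 < #|U|)%N -> 0 < eps < 1 -> forall H : hypergraph U d,
        solves_sampling 1 eps H alg /\
        query_cost_le (C * log2 #|U|%:R ^+ (3 * d + 9) / eps ^+ 2) H alg.
    have [eps01|] := boolP (0 < eps < 1); last first.
      by exists (constant_alg U d set0).
    have [U1|U2] := leqP #|U| 1.
      exists (constant_alg U d set0) => U0 _ H; split.
        by rewrite /solves_sampling few_vertices_no_edge //; exact: leq_ltn_trans U1 d2.
      by apply: constant_alg_cost; rewrite cost_ge0 // ltW.
    have [alg Halg] := sampler_exists d0 U2 eps01.
    exists alg => _ _ H; have [succ cost] := Halg H; split=> // w.
    apply: le_trans (cost w) _; rewrite ler_wpM2r ?invr_ge0 ?sqr_ge0 //.
    (* The descent costs only the power 3d+8; one more factor log n >= 1 is harmless. *)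
    rewrite ler_wpM2l ?(ltW C0) // (addnS _ 8) exprSr ler_peMr ?exprn_ge0 ?log2_ge0 ?(ltnW U2) //.
    have ln2 : 0 < ln 2 :> R by rewrite ln_gt0 // ltr1n.
    by rewrite /log2 ler_pdivlMr // mul1r ler_ln ?posrE ?ltr0n ?(ltnW U2) // ler_nat.
  exists (fun U eps => projT1 (cid (ex U eps))) => U eps U0 eps01 H.
  by case: cid => alg /= Halg; exact: Halg.
Qed.
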